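(* Let $(X,\tau)$ be a non-degenerate chainable continuum equipped with an ultrafilter order $\leq_{\mathcal{U}}^{\mathcal{D}}$. Let $\tau_{\mathcal{U}}^{\mathcal{D}}$ be the order topology generated by $\leq_{\mathcal{U}}^{\mathcal{D}}$. Then the following conditions are equivalent: (i) $(X,\tau)$ is Suslinean; (ii) $(X,\leq_{\mathcal{U}}^{\mathcal{D}})$ is order isomorphic to $([0,1],\leq)$; (iii) $(X,\tau_{\mathcal{U}}^{\mathcal{D}})$ is ccc; (iv) the identity map $\mathrm{id}\colon(X,\tau)\to(X,\tau_{\mathcal{U}}^{\mathcal{D}})$ is Borel measurable.
   Context: A continuum is a compact connected metrizable space; fix a metric generating its topology. A chain in $X$ is a finite sequence of open sets $d_1,\dots,d_k$ (its links) with $d_i\cap d_j\neq\varnothing\iff|i-j|\le 1$; its mesh is the maximum of the diameters of its links. $X$ is chainable if for every $\varepsilon>0$ it is covered by a chain of mesh less than $\varepsilon$. $\mathbb{N}=\{1,2,3,\dots\}$. Let $\mathcal{D}=\{D_n\}_{n\in\mathbb{N}}$ be a sequence of chains $D_n=\{d_{1,n},\dots,d_{k_n,n}\}$, each covering $X$, with $\mathrm{mesh}(D_n)\to 0$, and let $\mathcal{U}$ be a non-principal ultrafilter on $\mathbb{N}$. Write $x\leq_{D_n}y$ iff there exist $i\le j\le k_n$ with $x\in d_{i,n}$ and $y\in d_{j,n}$, and $x\leq_{\mathcal{U}}^{\mathcal{D}}y$ iff $\{n\in\mathbb{N}: x\leq_{D_n}y\}\in\mathcal{U}$. This is a linear order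 on $X$. An ultrafilter order on $X$ is any order of the form $\leq_{\mathcal{U}}^{\mathcal{D}}$ for some such $\mathcal{D}$ and $\mathcal{U}$. A continuum is Suslinean if any collection of its pairwise disjoint nondegenerate (more than one point) subcontinua is countable. A space is ccc if every family of pairwise disjoint nonempty open sets is countable. *)

(* Defs.v *)
From HB Require Import structures.
From mathcomp Require Import all_boot all_order all_algebra.
From mathcomp Require Import all_classical all_reals all_analysis.
From mathcomp Require Import lra zify.

Set Implicit Arguments.
Unset Strict Implicit.
Unset Printing Implicit Defensive.

Import Order.TTheory GRing.Theory Num.Theory.
Import numFieldNormedType.Exports.

Local Open Scope classical_set_scope.
Local Open Scope ring_scope.

Section Continua.
Context {R : realType} (X : metricType R).
Implicit Types (A K : set X) (d : seq (set X)).

Definition nondegenerate_set A := exists x y, [/\ A x, A y & x <> y].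

Definition subcontinuum K := [/\ K !=set0, compact K & connected K].

Definition continuum := subcontinuum [set: X].

Definition suslinean :=
  forall F : set (set X),
    (forall K, F K -> subcontinuum K /\ nondegenerate_set K) ->
    trivIset F id -> countable F.

Definition diam A : \bar R :=
  ereal_sup [set (mdist x y)%:E | x in A & y in A].

(** The links are numbered from 0: link [i] of [d] is [nth set0 d i]. *)
Definition is_chain d :=
  (forall i, (i < size d)%N -> open (nth set0 d i)) /\
  (forall i j, (i < size d)%N -> (j < size d)%N ->
     (nth set0 d i `&` nth set0 d j !=set0 <-> (`|i - j| <= 1)%N)).

Definition covers d := \bigcup_(i < size d) nth set0 d i = [set: X].

Definition mesh d : \bar R := \big[maxe/0%E]_(A <- d) diam A.

Definition chainable :=
  forall e : R, 0 < e -> exists d, [/\ is_chain d, covers d & (mesh d < e%:E)%E].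

Definition chain_le d (x y : X) :=
  exists i j, [/\ (i <= j)%N, (j < size d)%N, nth set0 d i x & nth set0 d j y].

Record chain_sequence (D : nat -> seq (set X)) : Prop := {
  chain_seq_chain : forall n, is_chain (D n) ;
  chain_seq_covers : forall n, covers (D n) ;
  chain_seq_mesh : mesh (D n) @[n --> \oo] --> 0%E }.

Definition ultra_le (D : nat -> seq (set X)) (U : set_system nat) (x y : X) :=
  U [set n | chain_le (D n) x y].

End Continua.

Definition nonprincipal_ultrafilter (I : Type) (U : set_system I) :=
  UltraFilter U /\ forall i, U <> principal_filter i.

Definition ccc (T : topologicalType) :=
  forall F : set (set T),
    (forall A, F A -> open A /\ A !=set0) -> trivIset F id -> countable F.

(** Written out rather than as [measurable_fun] because the library's measurable
    types are required to be pointed. *)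
Definition borel_measurable (S T : topologicalType) (f : S -> T) :=
  forall B, <<s @open T >> B -> <<s @open S >> (f @^-1` B).

Definition order_isomorphic_to_unit_interval (R : realType)
    (d : Order.disp_t) (T : orderType d) :=
  exists f : T -> R,
    set_bij [set: T] `[0, 1] f /\ (forall x y, (x <= y)%O <-> f x <= f y).

Section UltrafilterOrder.
Context {R : realType} {X : metricType R}.
Variables (D : nat -> seq (set X)) (U : set_system nat).
Hypotheses (hD : chain_sequence D) (hU : nonprincipal_ultrafilter U).

Let le := ultra_le D U.
Let chn n (x : X) i := (i < size (D n))%N /\ nth set0 (D n) i x.

Local Instance ultra_proper_filter : ProperFilter U.
Proof. by case: hU => -[]. Qed.

(** A non-principal ultrafilter contains every cofinite set. *)
Lemma ultra_eventually : \oo `<=` U.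
Proof.
have [UU np] := hU.
have nn n : U (~` [set n]).
  have [Un|//] := in_ultra_setVsetC [set n] UU.
  exfalso; apply: (np n); apply: esym.
  have FU : U `<=` principal_filter n.
    move=> A UA; apply/principal_filterP.
    by have /filter_ex[m [-> Am]] : U ([set n] `&` A) by exact: filterI.
  exact: (max_filter (principal_filter_proper n) FU).
have big N : U [set n | (N <= n)%N].
  elim: N => [|N IH]; first by apply: filterS filterT.
  apply: filterS (filterI IH (nn N)) => m [/= Nm mN].
  by rewrite ltn_neqAle Nm andbT; apply/eqP => /esym.
by move=> A [N _ NA]; apply: filterS (big N) => m; exact: NA.
Qed.

Local Lemma chn_dist n x i y : chn n x i -> chn n y i ->
  ((mdist x y)%:E <= mesh (D n))%E.
Proof.
move=> [iD xi] [_ yi]; rewrite /mesh.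
have : ((mdist x y)%:E <= diam (nth set0 (D n) i))%E.
  by apply: ereal_sup_ubound; exists x => //; exists y.
move=> /le_trans; apply.
elim: (D n) i iD {xi yi} => // A s IH [|i] /= h; rewrite big_cons le_max ?lexx//.
by rewrite IH ?orbT.
Qed.

Local Lemma chn_near n x i j : chn n x i -> chn n x j -> (`|i - j| <= 1)%N.
Proof.
move=> [iD xi] [jD xj]; have [_ h] := chain_seq_chain hD n.
by apply/(h i j iD jD); exists x.
Qed.

Local Lemma chn_ex n x : exists i, chn n x i.
Proof.
have : [set: X] x by [].
by rewrite -(chain_seq_covers hD n) => -[i /= iD xi]; exists i.
Qed.

Lemma ultra_mesh_lt (e : R) : 0 < e -> U [set n | (mesh (D n) < e%:E)%E].
Proof.
move=> e0; apply: ultra_eventually.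
have := chain_seq_mesh hD; move=> /(_ [set z | (z < e%:E)%E]); apply.
by apply: open_nbhs_nbhs; split; [exact: open_ereal_lt_ereal|rewrite /= lte_fin].
Qed.

Local Lemma chn_dist1 n x y i j : chn n x i -> chn n y j ->
  (`|i - j| <= 1)%N -> exists2 z, exists k, chn n x k /\ chn n z k
    & exists k, chn n z k /\ chn n y k.
Proof.
move=> [iD xi] [jD yj] ij; have [_ h] := chain_seq_chain hD n.
have /(h i j iD jD) [z [zi zj]] := ij.
by exists z; [exists i|exists j].
Qed.

Lemma ultra_le_total : total (fun x y => `[< le x y >]).
Proof.
move=> x y; have [UU _] := hU; apply/orP.
have [h|h] := in_ultra_setVsetC [set n | chain_le (D n) x y] UU.
  by left; apply/asboolP.
right; apply/asboolP; apply: filterS h => n /= nxy.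
have [[i [iD xi]] [j [jD yj]]] := (chn_ex n x, chn_ex n y).
have [ij|ji] := leqP i j; first by exfalso; apply: nxy; exists i, j.
by exists j, i; split => //; exact: ltnW.
Qed.

Lemma ultra_le_refl : reflexive (fun x y => `[< le x y >]).
Proof. by move=> x; have := ultra_le_total x x; rewrite orbb. Qed.

Lemma ultra_le_trans : transitive (fun x y => `[< le x y >]).
Proof.
move=> y x z /asboolP xy /asboolP yz.
have [->|xz] := eqVneq x z; first exact: ultra_le_refl.
have d0 : 0 < mdist x z / 2 by rewrite divr_gt0// mdist_gt0.
apply/asboolP; apply: filterS (filterI (ultra_mesh_lt d0) (filterI xy yz)).
move=> n [/= md [[i [j [ij jD xi yj]]] [k [l [kl lD yk zl]]]]].
have ci : chn n x i by split => //; exact: leq_ltn_trans jD.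
have ck : chn n y k by split => //; exact: leq_ltn_trans lD.
have cj : chn n y j by [].
have cl : chn n z l by [].
have jk := chn_near cj ck.
have [il|li] := leqP i l; first by exists i, l.
exfalso; have ij' : i = j by lia.
have kl' : k = l by lia.
move: cj cl; rewrite -ij' -kl' => cj cl.
have h1 := le_lt_trans (chn_dist ci cj) md.
have h2 := le_lt_trans (chn_dist ck cl) md.
move: h1 h2; rewrite !lte_fin.
by have := metric_triangle x y z; lra.
Qed.

Lemma ultra_le_anti : antisymmetric (fun x y => `[< le x y >]).
Proof.
move=> x y /andP[/asboolP xy /asboolP yx].
apply/eqP; apply/negPn/negP => nxy.
have d0 : 0 < mdist x y / 3 by rewrite divr_gt0// mdist_gt0.
have : U ([set n | (mesh (D n) < (mdist x y / 3)%:E)%E] `&`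
    ([set n | chain_le (D n) x y] `&` [set n | chain_le (D n) y x])).
  by apply: filterI; [exact: ultra_mesh_lt|exact: filterI].
move=> /filter_ex[n [/= md [[i [j [ij jD xi yj]]] [k [l [kl lD yk xl]]]]]].
have ci : chn n x i by split => //; exact: leq_ltn_trans jD.
have ck : chn n y k by split => //; exact: leq_ltn_trans lD.
have cj : chn n y j by [].
have cl : chn n x l by [].
have jk := chn_near cj ck.
have il := chn_near ci cl.
have step u v w : chn n u w -> chn n v w -> mdist u v < mdist x y / 3.
  by move=> cu cv; rewrite -lte_fin; exact: le_lt_trans (chn_dist cu cv) md.
have [ij1|ij2] : (`|i - j| <= 1)%N \/ (j = i.+2) by lia.
  have [z [a [xa za]] [b [zb yb]]] := chn_dist1 ci cj ij1.
  have := step _ _ _ xa za; have := step _ _ _ zb yb.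
  by have := metric_triangle x z y; have := mdist_ge0 x y; lra.
have il' : (`|l - k| <= 1)%N by lia.
have [z [a [xa za]] [b [zb yb]]] := chn_dist1 cl ck il'.
have := step _ _ _ xa za; have := step _ _ _ zb yb.
by have := metric_triangle x z y; have := mdist_ge0 x y; lra.
Qed.

Definition ultra_order
  of chain_sequence D & nonprincipal_ultrafilter U : Type := X.

Fact ultra_order_display : Order.disp_t. Proof. exact: Order.Disp tt tt. Qed.

HB.instance Definition _ := Choice.copy (ultra_order hD hU) X.
HB.instance Definition _ := Order.Le_isPOrder.Build ultra_order_display
  (ultra_order hD hU) ultra_le_refl ultra_le_anti ultra_le_trans.
HB.instance Definition _ := Order.POrder_isTotal.Build ultra_order_display
  (ultra_order hD hU) ultra_le_total.

Lemma ultra_orderE (x y : ultra_order hD hU) :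
  (x <= y)%O <-> ultra_le D U x y.
Proof. by split => /asboolP. Qed.

End UltrafilterOrder.

(* Main.v *)
Require Import Defs.
From HB Require Import structures.
From mathcomp Require Import all_boot all_order all_algebra.
From mathcomp Require Import all_classical all_reals all_analysis.
From mathcomp Require Import lra zify.

(** The link between the two topologies is that every subcontinuum [K] is convex for
the ultrafilter order: the links of a chain that meet [K] are consecutive, and a
point outside of [K] lies, for small mesh, in links that do not meet [K]
([ultra_continuum_order]). Everything else about the order comes from this convexity.

From Suslinean to the unit interval. In a Suslinean space every nondegenerate
continuum is a union of two proper subcontinua ([suslinean_decomposable]). A minimal
cofinal subcontinuum of a continuum cannot be such a union, so it is a point: every
continuum has a last and, dually, a first point ([subcontinuum_max]). Given a cut of
the order, the same argument excludes a minimal continuum meeting both sides; hence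
some chain of such continua shrinks to a continuum on one side, and convexity makes
its last or first point the only point at the cut ([continuum_cut]). So the order is
complete and has no jumps. For each bound on the size choose a maximal disjoint, hence
countable, family of small continua; their end points meet every nondegenerate
continuum. As a small continuum around a point of an open interval lies in the
interval, these end points are order dense, and Cantor's theorem
([order_isomorphic_of_separable]) applies.

From the unit interval to the countable chain condition, choose points with rational
coordinates. The countable chain condition makes the space Suslinean, as a
nondegenerate continuum contains an open interval. In a Suslinean space a ray
with end point [x] is a countable union of continua, namely of components of
complements of balls around [x] ([suslinean_ray_borel]); and the order topology
has a countable base of intervals, so that its open sets are Borel.

From measurability to Suslinean. If the space is not Suslinean, a Cantor scheme turns an
uncountable family of disjoint continua into one indexed by all sequences of
bits ([not_suslinean_perfect_family]), hence by all codes of Borel sets as results of the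
Suslin operation ([borel_suslin]). Each of these continua contains an open interval,
and unions of these intervals are open in the order topology. A diagonal argument
gives such a union without a code, so it is not Borel. *)

Set Implicit Arguments.
Unset Strict Implicit.
Unset Printing Implicit Defensive.

Import Order.TTheory GRing.Theory Num.Theory.

Local Open Scope classical_set_scope.
Local Open Scope ring_scope.

(** * Connectedness in compact Hausdorff spaces *)

Section Topology.
Context {T : topologicalType}.
Implicit Types (A B K P Q O : set T).

Lemma connected_sub_openU K A B : connected K -> open A -> open B ->
  A `&` B = set0 -> K `<=` A `|` B -> K `<=` A \/ K `<=` B.
Proof.
have sep C D : open D -> C `&` D = set0 -> closure C `&` D = set0.
  move=> oD /disjoints_subset CD; apply/disjoints_subset.
  by rewrite (iffLR (closure_id (~` D)) (open_closedC oD)); exact: closureS.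
move=> cK oA oB AB KAB; apply: connected_subset => //; split; first exact: sep.
by rewrite setIC; apply: sep => //; rewrite setIC.
Qed.

Lemma connected_sub_closedU K A B : connected K -> closed A -> closed B ->
  A `&` B = set0 -> K `<=` A `|` B -> K `<=` A \/ K `<=` B.
Proof.
move=> cK oA oB AB KAB; apply: connected_subset => //; split.
  by rewrite -(iffLR (closure_id _)).
by rewrite -(iffLR (closure_id _)).
Qed.

Lemma closed_connected K : closed K ->
  (forall P Q, closed P -> closed Q -> P `|` Q = K -> P `&` Q = set0 ->
     P !=set0 -> Q !=set0 -> False) -> connected K.
Proof.
move=> cK h; apply/connectedP => E [E0 KE [s1 s2]].
have cE b : closure (E b) `<=` E false `|` E true.
  rewrite -KE (iffLR (closure_id K) cK); apply: closureS.
  by rewrite KE => x Ex; case: b Ex; [right|left].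
have clE b : closed (E b).
  apply/closure_id/seteqP; split; first exact: subset_closure.
  move=> x Ex; have [] := cE b x Ex; case: b Ex => // Ex E'x.
    by exfalso; have : set0 x by rewrite -s2.
  by exfalso; have : set0 x by rewrite -s1.
apply: (h (E false) (E true)) => //.
apply/disjoints_subset => x Ex E'x.
have : set0 x by rewrite -s1; split => //; exact: subset_closure.
by [].
Qed.

Lemma directed_closed_sub_open (F : set (set T)) O : compact [set: T] ->
  F !=set0 -> (forall A, F A -> closed A) ->
  (forall A B, F A -> F B -> exists2 C, F C & C `<=` A `&` B) ->
  open O -> \bigcap_(A in F) A `<=` O -> exists2 A, F A & A `<=` O.
Proof.
move=> cT [A0 FA0] Fcl Fdir oO FO; apply: contrapT => nF.
pose G := filter_from F (fun A => A `\` O).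
have FG : ProperFilter G.
  apply: filter_from_proper.
    apply: filter_from_filter; first by exists A0.
    move=> A B FA FB; have [C FC CAB] := Fdir A B FA FB.
    by exists C => // x [Cx Ox]; have [Ax Bx] := CAB x Cx.
  move=> A FA; apply/set0P/eqP => AO; apply: nF; exists A => // x Ax.
  by apply: contrapT => nOx; have : set0 x by rewrite -AO.
have [x [_ Gx]] := cT G FG filterT.
have ox : ~ O x.
  move=> Ox; have GA : G (A0 `\` O) by exists A0.
  by have [y [[_ nOy] Oy]] := Gx _ _ GA (open_nbhs_nbhs (conj oO Ox)).
apply/ox/FO => A FA; rewrite (iffLR (closure_id A) (Fcl A FA)) => B Bx.
have GA : G A by exists A => // y [].
exact: (Gx _ _ GA Bx).
Qed.

Lemma disjoint_closed_separated P Q : hausdorff_space T -> compact [set: T] ->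
  closed P -> closed Q -> P `&` Q = set0 ->
  exists A B, [/\ open A, open B, P `<=` A, Q `<=` B & A `&` B = set0].
Proof.
move=> hT cT clP clQ PQ.
have nQ : set_nbhs P (~` Q).
  apply/set_nbhsP; exists (~` Q); split => //; first exact: closed_openC.
  exact/disjoints_subset.
have [B /set_nbhsP[C [oC PC CB]] clBQ] := compact_normal hT cT clP nQ.
exists C, (~` closure B); split => //.
- exact/closed_openC/closed_closure.
- by move=> x Qx Bx; exact: (clBQ x Bx).
- by apply/disjoints_subset => x Cx; rewrite setCK; exact/subset_closure/CB.
Qed.

(** A disconnection of the intersection would, by compactness, already
disconnect some member of the family. *)
Lemma directed_bigcap_connected (F : set (set T)) :
  hausdorff_space T -> compact [set: T] ->
  F !=set0 -> (forall A, F A -> closed A /\ connected A) ->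
  (forall A B, F A -> F B -> exists2 C, F C & C `<=` A `&` B) ->
  connected (\bigcap_(A in F) A).
Proof.
move=> hT cT F0 Fcc Fdir; set K := \bigcap_(A in F) A.
have cK : closed K by apply: closed_bigI => A /Fcc[].
apply: closed_connected => // P Q cP cQ PQK PQ [p Pp] [q Qq].
have [A [B [oA oB PA QB AB]]] := disjoint_closed_separated hT cT cP cQ PQ.
have KAB : K `<=` A `|` B.
  by rewrite -PQK => x [/PA|/QB] ?; [left|right].
have [C FC CAB] := directed_closed_sub_open cT F0 (fun A FA => (Fcc A FA).1)
  Fdir (openU oA oB) KAB.
have KC : K `<=` C by move=> x; exact.
have [CA|CB] := connected_sub_openU (Fcc C FC).2 oA oB AB CAB.
- have : (A `&` B) q; last by rewrite AB.
  by split; [apply/CA/KC; rewrite -PQK; right|exact: QB].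
- have : (A `&` B) p; last by rewrite AB.
  by split; [exact: PA|apply/CB/KC; rewrite -PQK; left].
Qed.

(** The relatively clopen subsets of [E], described by closed sets of the ambient
space instead of the subspace topology. *)
Definition clopen_part E P :=
  closed P /\ exists Q, [/\ closed Q, P `|` Q = E & P `&` Q = set0].

Definition quasicomponent E x := \bigcap_(P in [set P | clopen_part E P /\ P x]) P.

Lemma clopen_partI E P Q : clopen_part E P -> clopen_part E Q ->
  clopen_part E (P `&` Q).
Proof.
move=> [cP [P' [cP' PE P0]]] [cQ [Q' [cQ' QE Q0]]]; split; first exact: closedI.
exists (P' `|` Q'); split; first exact: closedU.
- apply/seteqP; split=> x.
    by case=> [[Px _]|[P'x|Q'x]]; [rewrite -PE; left|rewrite -PE; right|rewrite -QE; right].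
  move=> Ex; have : (P `|` P') x by rewrite PE.
  have : (Q `|` Q') x by rewrite QE.
  by case=> ?; case=> ?; [left|right; left|right; right|right; left].
- apply/disjoints_subset => x [Px Qx] [P'x|Q'x].
    by have : (P `&` P') x by []; rewrite P0.
  by have : (Q `&` Q') x by []; rewrite Q0.
Qed.

Lemma quasicomponent_sub E x : closed E -> E x -> quasicomponent E x `<=` E.
Proof.
move=> cE Ex y; apply; split => //; split => //; exists set0.
by split; [exact: closed0|rewrite setU0|rewrite setI0].
Qed.

(** By compactness, a splitting of the intersection extends to one of the clopen parts
around [x], which is then cut down to a smaller clopen part around [x]. *)
Lemma quasicomponent_connected E x : hausdorff_space T -> compact [set: T] ->
  closed E -> E x -> connected (quasicomponent E x).
Proof.
move=> hT cT cE Ex; set K := quasicomponent E x.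
pose F := [set P | clopen_part E P /\ P x].
have FE : F E.
  split=> //; split => //; exists set0.
  by split; [exact: closed0|rewrite setU0|rewrite setI0].
have cK : closed K by apply: closed_bigI => A [[]].
apply: closed_connected => // P Q cP cQ PQK PQ P0 Q0.
wlog Px : P Q cP cQ PQK PQ P0 Q0 / P x => [wl|].
  have : (P `|` Q) x by rewrite PQK => A [].
  case=> [Px|Qx]; first exact: (wl P Q).
  by apply: (wl Q P) => //; rewrite (setUC,setIC).
have [A [B [oA oB PA QB AB]]] := disjoint_closed_separated hT cT cP cQ PQ.
have KAB : K `<=` A `|` B by rewrite -PQK => y [/PA|/QB] ?; [left|right].
have [||C [[cC [C' [cC' CE C0]]] Cx] CAB] :=
    directed_closed_sub_open cT (ex_intro _ E FE) _ _ (openU oA oB) KAB.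
- by move=> ? [[]].
- move=> C D [hC Cx] [hD Dx]; exists (C `&` D) => //.
  by split => //; exact: clopen_partI.
have FCB : F (C `\` B).
  have Bx : ~ B x.
    by move=> Bx; have : (A `&` B) x; [split=> //; exact: PA|rewrite AB].
  split=> //; split; first by apply: closedI => //; exact: open_closedC.
  exists ((C `\` A) `|` C'); split.
  - by apply: closedU => //; apply: closedI => //; exact: open_closedC.
  - apply/seteqP; split => y.
      by case=> [[Cy _]|[[Cy _]|C'y]]; rewrite -CE; [left|left|right].
    rewrite -CE => -[Cy|]; last by right; right.
    have [Ay|By] := CAB y Cy.
      left; split=> // By; have : (A `&` B) y by [].
      by rewrite AB.
    right; left; split => // Ay; have : (A `&` B) y by [].
    by rewrite AB.
  - apply/disjoints_subset => y [Cy nBy] [[_ nAy]|C'y].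
      by case: (CAB y Cy).
    by have : (C `&` C') y by []; rewrite C0.
have [q Qq] := Q0; have : K q by rewrite -PQK; right.
by move=> /(_ _ FCB)[_]; apply; exact: QB.
Qed.

End Topology.

(** * Subcontinua of a compact metric space *)

Section Continua.
Context {R : realType} {X : metricType R}.
Implicit Types (A B E K M : set X).
Hypothesis cptX : compact [set: X].

Lemma ballP (x y : X) (e : R) : ball x e y <-> mdist x y < e.
Proof. by rewrite ballEmdist. Qed.

Lemma open_ball_sub (O : set X) x : open O -> O x ->
  exists2 e : R, 0 < e & ball x e `<=` O.
Proof.
by move=> oO Ox; have /nbhs_ballP[e e0 h] := open_nbhs_nbhs (conj oO Ox); exists e.
Qed.

Lemma metric_ball_open (x : X) (e : R) : open (ball x e).
Proof.
rewrite openE => y; rewrite ballP => xy; apply/nbhs_ballP.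
exists (e - mdist x y); first by rewrite /= subr_gt0.
by move=> z; rewrite !ballP; have := metric_triangle x y z; lra.
Qed.

Lemma metric_closed_ball_closed (x : X) (e : R) : closed [set y | mdist x y <= e].
Proof.
rewrite -openC openE => y /= /negP; rewrite -ltNge => xy; apply/nbhs_ballP.
exists (mdist x y - e); first by rewrite /= subr_gt0.
move=> z; rewrite ballP /= => yz; apply/negP; rewrite -ltNge.
by have := metric_triangle x z y; rewrite (metric_sym z y); lra.
Qed.

Lemma subcontinuum_closed K : subcontinuum K -> closed K.
Proof. by case=> _ cK _; apply: compact_closed => //; exact: metric_hausdorff. Qed.

Lemma closed_subcontinuum K : K !=set0 -> closed K -> connected K ->
  subcontinuum K.
Proof. by move=> K0 cK conK; split=> //; exact: subclosed_compact cptX _. Qed.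

Lemma subcontinuumU A B : subcontinuum A -> subcontinuum B ->
  A `&` B !=set0 -> subcontinuum (A `|` B).
Proof.
move=> cA cB AB; have [x [Ax Bx]] := AB; apply: closed_subcontinuum.
- by exists x; left.
- by apply: closedU; exact: subcontinuum_closed.
- by apply: connectedU => //; [case: cA|case: cB].
Qed.

Lemma component_subcontinuum E x : closed E -> E x ->
  subcontinuum (connected_component E x).
Proof.
move=> cE Ex; apply: closed_subcontinuum.
- by exists x; exact: connected_component_refl.
- exact: component_closed.
- exact: component_connected.
Qed.

Lemma chain_bigcap_subcontinuum (F : set (set X)) : F !=set0 ->
  (forall A, F A -> subcontinuum A) -> total_on F subset ->
  subcontinuum (\bigcap_(A in F) A).
Proof.
move=> F0 Fsub Ftot.
have Fdir A B : F A -> F B -> exists2 C, F C & C `<=` A `&` B.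
  move=> FA FB; have [AB|BA] := Ftot A B FA FB; [exists A|exists B] => // x ?.
    by split => //; exact: AB.
  by split => //; exact: BA.
have Fcl A : F A -> closed A by move=> /Fsub; exact: subcontinuum_closed.
apply: closed_subcontinuum; last 2 first.
- exact: closed_bigI.
- apply: directed_bigcap_connected => // [|A FA]; first exact: metric_hausdorff.
  by split; [exact: Fcl|case: (Fsub A FA)].
apply/set0P/eqP => F_0.
have [A FA] : exists2 A, F A & A `<=` set0.
  by apply: directed_closed_sub_open => //; [exact: open0|rewrite F_0].
by case: (Fsub A FA) => -[x Ax] _ _ /(_ x Ax).
Qed.

(** Boundary bumping: if the quasicomponent of [x] in a closed ball were [x] alone,
a clopen part of the ball would lie in the interior of the ball and split [K]. *)
Lemma small_subcontinuum K x (e : R) : subcontinuum K -> nondegenerate_set K ->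
  K x -> 0 < e -> exists M, [/\ subcontinuum M, nondegenerate_set M, M x,
    M `<=` K & M `<=` ball x e].
Proof.
move=> sK [u [v [Ku Kv uv]]] Kx e0.
have [y Ky yx] : exists2 y, K y & x != y.
  have [xu|] := eqVneq x u; last by exists u.
  by exists v => //; rewrite xu; apply/eqP.
pose r := Num.min (e / 2) (mdist x y).
have r0 : 0 < r by rewrite lt_min mdist_gt0 yx andbT; lra.
have re : r < e by rewrite gt_min; apply/orP; left; lra.
have rxy : r <= mdist x y by rewrite ge_min lexx orbT.
pose E := K `&` [set y | mdist x y <= r].
have clK := subcontinuum_closed sK.
have cE : closed E by apply: closedI => //; exact: metric_closed_ball_closed.
have Ex : E x by split => //=; rewrite mdistxx ltW.
have hX : hausdorff_space X by exact: metric_hausdorff.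
pose Q := quasicomponent E x.
have QE : Q `<=` E by exact: quasicomponent_sub.
have Qx : Q x by move=> A [].
have sQ : subcontinuum Q.
  apply: closed_subcontinuum; first by exists x.
    by apply: closed_bigI => A [[]].
  exact: quasicomponent_connected.
have QK : Q `<=` K by move=> z /QE[].
have Qb : Q `<=` ball x e.
  by move=> z /QE[_ /= xz]; rewrite ballP; exact: le_lt_trans re.
have [ndQ|dQ] := pselect (nondegenerate_set Q); first by exists Q.
exfalso; have Qball : Q `<=` ball x r.
  move=> z Qz; have -> : z = x; last by rewrite ballP mdistxx.
  by apply: contrapT => zx; apply: dQ; exists z, x.
have [|||P [[cP [P' [cP' PE P0]]] Px] Pr] := directed_closed_sub_open cptX
    (ex_intro _ E _) _ _ (metric_ball_open x r) Qball.
- split=> //; split => //; exists set0.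
  by split; [exact: closed0|rewrite setU0|rewrite setI0].
- by move=> ? [[]].
- move=> C D [hC Cx] [hD Dx]; exists (C `&` D) => //.
  by split => //; exact: clopen_partI.
have cC : closed (P' `|` ~` ball x r).
  by apply: closedU => //; apply: open_closedC; exact: metric_ball_open.
have dC : P `&` (P' `|` ~` ball x r) = set0.
  apply/disjoints_subset => z Pz [P'z|]; last by apply; exact: Pr.
  by have : (P `&` P') z by []; rewrite P0.
have KC : K `<=` P `|` (P' `|` ~` ball x r).
  move=> z Kz; have [xz|] := pselect (ball x r z); last by right; right.
  have : E z by split=> //=; rewrite ltW// -ballP.
  by rewrite -PE => -[]; [left|right; left].
have [_ _ conK] := sK.
have [KP|KP] := connected_sub_closedU conK cP cC dC KC.
- by have := Pr y (KP y Ky); rewrite ballP ltNge rxy.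
- have : set0 x; last by [].
  by rewrite -dC; split => //; exact: KP.
Qed.

End Continua.

(** * Decomposability of Suslinean continua *)

Lemma countable_enumeration {T : Type} (A : set T) : countable A -> A !=set0 ->
  exists f : nat -> T, range f = A.
Proof.
elim/Pchoice: T => T in A *.
move=> /countable_injP[g ginj] [a Aa].
pose f n := xget a [set x | A x /\ g x = n].
have fA n : A (f n).
  rewrite /f; by case: xgetP => [x _ []|_].
exists f; apply/seteqP; split=> [_ [n _ <-]//|x Ax].
exists (g x) => //; rewrite /f; case: xgetP => [y _ [Ay gy]|/(_ x)[]//].
apply: ginj; rewrite ?inE //.
Qed.

Section Indecomposable.
Context {R : realType} {X : metricType R}.
Implicit Types (A B C E K M : set X).
Hypothesis cptX : compact [set: X].

Lemma metric_regular_open (O : set X) x : open O -> O x ->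
  exists U, [/\ open U, U x & closure U `<=` O].
Proof.
move=> oO Ox; have [e e0 eO] := open_ball_sub oO Ox.
exists (ball x (e / 2)); split; first exact: metric_ball_open.
  by rewrite ballP mdistxx divr_gt0.
apply: subset_trans eO.
have cB := @metric_closed_ball_closed R X x (e / 2).
apply: (@subset_trans _ [set y | mdist x y <= e / 2]).
  by rewrite (iffLR (closure_id _) cB); apply: closureS => y /ballP /ltW.
by move=> y /= xy; apply/ballP; lra.
Qed.

(** Baire's theorem, with compactness in place of completeness: the closures of a
shrinking sequence of open sets, the next of which avoids [C n], have a common
point. *)
Lemma compact_Baire K (C : nat -> set X) : closed K -> K !=set0 ->
  (forall n, closed (C n)) ->
  (forall n O, open O -> O `&` K !=set0 -> ~ O `&` K `<=` C n) ->
  exists2 x, K x & forall n, ~ C n x.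
Proof.
move=> cK [k Kk] cC Cint.
pose good U := open U /\ U `&` K !=set0.
have /choice[step hstep] (p : nat * set X) : exists V, good p.2 ->
    [/\ good V, closure V `<=` p.2 & closure V `<=` ~` C p.1].
  have [[oU UK]|ng] := pselect (good p.2); last by exists set0.
  have [x [[Ux Kx] Cx]] : exists x, (p.2 `&` K) x /\ ~ C p.1 x.
    apply: contrapT => h; apply: (Cint p.1 _ oU UK) => x hx.
    by apply: contrapT => nx; apply: h; exists x.
  have oV : open (p.2 `&` ~` C p.1) by apply: openI => //; exact: closed_openC.
  have [V [opV Vx clV]] := metric_regular_open oV (conj Ux Cx).
  exists V => _; split; first by split => //; exists x.
    by move=> y /clV[].
  by move=> y /clV[].
pose U := fix U n := if n is m.+1 then step (m, U m) else setT.
have goodU n : good (U n).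
  elim: n => [|n IH]; first by split; [exact: openT|exists k].
  by have [] := hstep (n, U n) IH.
have UD m n : (m <= n)%N -> U n `<=` U m.
  elim: n => [|n IH]; first by rewrite leqn0 => /eqP ->.
  rewrite leq_eqVlt => /orP[/eqP <-//|/IH h]; apply: subset_trans h.
  have [_ h _] := hstep (n, U n) (goodU n).
  exact: subset_trans (@subset_closure _ _) h.
pose F := [set A | exists n, A = closure (U n) `&` K].
have [x Fx] : \bigcap_(A in F) A !=set0.
  apply/set0P/eqP => F0.
  have [|||||] := @directed_closed_sub_open X F set0 cptX.
  - by exists (closure (U 0%N) `&` K), 0%N.
  - by move=> _ [n ->]; apply: closedI => //; exact: closed_closure.
  - move=> _ _ [m ->] [n ->]; exists (closure (U (maxn m n)) `&` K).
      by exists (maxn m n).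
    by move=> y [Uy Ky]; split; split => //; move: Uy; apply: closureS;
      apply: UD; [exact: leq_maxl|exact: leq_maxr].
  - exact: open0.
  - by rewrite F0.
  - move=> _ [n ->] Un0; have [_ [y [Uy Ky]]] := goodU n.
    by apply: (Un0 y); split => //; exact: subset_closure.
exists x; first by have [] := Fx (closure (U 0%N) `&` K) (ex_intro _ 0%N erefl).
move=> n; have [Ux Kx] := Fx _ (ex_intro _ n.+1 erefl).
by have [_ _] := hstep (n, U n) (goodU n); apply.
Qed.

Definition indecomposable K := forall A B, subcontinuum A -> subcontinuum B ->
  A `|` B = K -> A = K \/ B = K.

(** If [A] contained a relatively open part of [K], then [closure (K `\` A)] would
be a proper closed set; whether it is connected or splits into [P] and [Q],
it yields a decomposition of [K], with parts [A `|` P] and [A `|` Q] in the second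
case. *)
Lemma indecomposable_interior K A (O : set X) : subcontinuum K ->
  indecomposable K -> subcontinuum A -> A `<=` K -> A <> K ->
  open O -> O `&` K !=set0 -> ~ O `&` K `<=` A.
Proof.
move=> sK iK sA AK AnK oO [w [Ow Kw]] OA.
have cK := subcontinuum_closed sK; have cA := subcontinuum_closed sA.
have [z Kz Az] : exists2 z, K z & ~ A z.
  apply: contrapT => h; apply: AnK; apply/seteqP; split => // z Kz.
  by apply: contrapT => Az; apply: h; exists z.
pose H := closure (K `\` A).
have cH : closed H by exact: closed_closure.
have HK : H `<=` K.
  by rewrite (iffLR (closure_id K) cK); apply: closureS => y [].
have KAH : K `<=` A `|` H.
  move=> y Ky; have [|nAy] := pselect (A y); first by left.
  by right; apply: subset_closure.
have nHw : ~ H w.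
  move=> Hw; have [y [[Ky nAy] Oy]] := Hw O (open_nbhs_nbhs (conj oO Ow)).
  exact/nAy/OA.
have sAP P Q : closed P -> closed Q -> P `|` Q = H -> P `&` Q = set0 ->
    subcontinuum (A `|` P).
  move=> cP cQ PQH PQ; apply: closed_subcontinuum => //.
  - by have [[a Aa] _ _] := sA; exists a; left.
  - exact: closedU.
  apply: closed_connected; first exact: closedU.
  move=> M N cM cN MN MN0.
  wlog AM : M N cM cN MN MN0 / A `<=` M.
    move=> wl M0 N0; have [_ _ conA] := sA.
    have [|AM|AN] := connected_sub_closedU conA cM cN MN0.
    - by move=> y Ay; rewrite MN; left.
    - exact: (wl M N).
    - by apply: (wl N M) => //; rewrite (setUC,setIC).
  move=> [m Mm] [n Nn].
  have NP : N `<=` P.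
    move=> y Ny; have : (A `|` P) y by rewrite -MN; right.
    case=> // Ay; have : (M `&` N) y by split => //; exact: AM.
    by rewrite MN0.
  have dN : N `&` (M `|` Q) = set0.
    apply/disjoints_subset => y Ny [My|Qy].
      by have : (M `&` N) y by []; rewrite MN0.
    by have : (P `&` Q) y; [split => //; exact: NP|rewrite PQ].
  have KN : K `<=` N `|` (M `|` Q).
    move=> y /KAH[Ay|]; first by right; left; exact: AM.
    rewrite -PQH => -[Py|]; last by right; right.
    have : (M `|` N) y by rewrite MN; right.
    by case=> ?; [right; left|left].
  have [_ _ conK] := sK.
  have [KsN|KsN] := connected_sub_closedU conK cN (closedU cM cQ) dN KN.
  - have [[a Aa] _ _] := sA; have : (M `&` N) a; last by rewrite MN0.
    by split; [exact: AM|apply/KsN/AK].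
  - have : (N `&` (M `|` Q)) n; last by rewrite dN.
    split => //; apply: KsN; have : (A `|` P) n by rewrite -MN; right.
    by case=> [/AK//|Pn]; apply: HK; rewrite -PQH; left.
have [conH|nconH] := pselect (connected H).
  have [||/AnK//|HeK] := iK A H sA.
  - by apply: closed_subcontinuum => //; exists z; apply: subset_closure.
  - by apply/seteqP; split => // y [/AK|/HK].
  - by apply: nHw; rewrite HeK.
apply: nconH; apply: closed_connected => // P Q cP cQ PQH PQ P0 Q0.
have prop P' Q' : closed P' -> closed Q' -> P' `|` Q' = H -> P' `&` Q' = set0 ->
    Q' !=set0 -> A `|` P' <> K.
  move=> cP' cQ' PQH' PQ' [q Qq] APK.
  have Hq : H q by rewrite -PQH'; right.
  have oP : open (~` P') by exact: closed_openC.
  have nPq : ~ P' q by move=> Pq; have : (P' `&` Q') q by []; rewrite PQ'.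
  have [y [[Ky nAy] Py]] := Hq _ (open_nbhs_nbhs (conj oP nPq)).
  by move: Ky; rewrite -APK => -[].
have QPH : Q `|` P = H by rewrite setUC.
have QP : Q `&` P = set0 by rewrite setIC.
have [|APK|AQK] := iK _ _ (sAP P Q cP cQ PQH PQ) (sAP Q P cQ cP QPH QP).
- rewrite setUACA setUid PQH; apply/seteqP; split=> // y.
  by case=> [/AK|/HK].
- exact: (prop P Q).
- exact: (prop Q P).
Qed.

(** A maximal disjoint subfamily of [P] meets all members of [P], and it is countable
in a Suslinean space. *)
Lemma suslinean_meeting_family (P : set (set X)) : suslinean X ->
  (forall K, P K -> subcontinuum K /\ nondegenerate_set K) ->
  exists F : set (set X), [/\ countable F, F `<=` P &
    forall K, P K -> exists2 A, F A & A `&` K !=set0].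
Proof.
move=> sX hP; have [F [FP tF maxF]] := ex_maximal_disjoint_subcollection id P.
exists F; split => //; first by apply: sX => // K /FP; exact: hP.
move=> K PK; apply: contrapT => h.
have K0 : K !=set0 by have [[]] := hP K PK.
have hF A : F A -> A `&` K = set0.
  by move=> FA; apply/eqP/negPn/negP => /set0P AK; apply: h; exists A.
apply: (maxF (F `|` [set K])).
- split; first by move=> A; left.
  move=> /(_ K (or_intror erefl)) FK; have := hF K FK; rewrite setIid.
  by apply/eqP/set0P.
- by move=> A [/FP//|->].
- move=> A B [FA|->] [FB|->] //; first exact: tF.
    by rewrite (hF _ FA) => -[].
  by rewrite setIC (hF _ FB) => -[].
Qed.

Definition countable_base (B : nat -> set X) := (forall i, open (B i)) /\
  forall x (e : R), 0 < e -> exists i, B i x /\ B i `<=` ball x e.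

(** By Baire's theorem an indecomposable continuum is not a union of countably many
proper subcontinua. But countably many small subcontinua, which no other small one
avoids, reach every composant, and each composant is a countable union of proper
subcontinua. *)
Lemma suslinean_decomposable (B : nat -> set X) K : countable_base B ->
  suslinean X -> subcontinuum K -> nondegenerate_set K -> ~ indecomposable K.
Proof.
move=> [oB baseB] sX sK ndK iK.
have cK := subcontinuum_closed sK.
pose P := [set M | [/\ subcontinuum M, nondegenerate_set M, M `<=` K & M <> K]].
have [F [cF FP Fmeet]] : exists F : set (set X), [/\ countable F, F `<=` P &
    forall K, P K -> exists2 A, F A & A `&` K !=set0].
  by apply: suslinean_meeting_family => // M [].
have K0 : K !=set0 by case: sK.
have [k Kk] := K0.
pose pt (f : set X) := xget k f.
have ptf f : F f -> f (pt f).
  move=> /FP[[[x fx] _ _] _ _ _]; rewrite /pt; case: xgetP => // nf.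
  by case: (nf x).
pose D := [set q : set X * nat | F q.1 /\ (B q.2 `&` K !=set0 /\ ~ B q.2 (pt q.1))].
pose comp (q : set X * nat) := connected_component (K `\` B q.2) (pt q.1).
have hE q : D q -> [/\ subcontinuum (comp q), comp q `<=` K & comp q <> K].
  case: q => f i [/= Ff [[y [By Ky]] nB]].
  have [_ _ fK _] := FP f Ff.
  split.
  - apply: component_subcontinuum => //; last by split => //=; exact: (fK _ (ptf _ Ff)).
    by apply: closedI => //; exact: open_closedC.
  - by move=> x /connected_component_sub[].
  - move=> cKe; have : comp (f, i) y by rewrite cKe.
    by move=> /connected_component_sub[].
(* A small continuum around [x] meets some [f] in [F]; their union is a proper
   subcontinuum, so it misses some basic set [B i]. *)
have cover x : K x -> exists2 q, D q & comp q x.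
  move=> Kx; have [y Ky xy] : exists2 y, K y & x != y.
    have [u [v [Ku Kv uv]]] := ndK.
    have [xu|] := eqVneq x u; last by exists u.
    by exists v => //; rewrite xu; apply/eqP.
  have [|M [sM ndM Mx MK Mb]] := small_subcontinuum cptX sK ndK Kx (e := mdist x y).
    by rewrite mdist_gt0.
  have PM : P M.
    split => // MeK; have : M y by rewrite MeK.
    by move=> /Mb /ballP; rewrite ltxx.
  have [f Ff fM] := Fmeet M PM.
  have [sf ndf fK fnK] := FP f Ff.
  have sH := subcontinuumU cptX sf sM fM.
  have [z Kz Hz] : exists2 z, K z & ~ (f `|` M) z.
    apply: contrapT => h; have [_ _ _ MnK] := PM.
    have [|/fnK//|/MnK//] := iK f M sf sM.
    apply/seteqP; split => [u [/fK|/MK]//|u Ku]; apply: contrapT => nu.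
    by apply: h; exists u.
  have [e e0 eH] := open_ball_sub (closed_openC (subcontinuum_closed sH)) Hz.
  have [i [Biz Bie]] := baseB z e e0.
  have BH : f `|` M `<=` ~` B i by move=> u Hu /Bie /eH; apply.
  exists (f, i); first split => //=.
    by split; [exists z|apply/BH; left; exact: ptf].
  exists (f `|` M); last by right.
  split; [by left; exact: ptf| |by case: sH].
  by move=> u Hu; split; [case: Hu => [/fK|/MK]|exact: BH].
have cD : countable D.
  apply: (sub_countable (B := F `*` [set: nat])); last exact: countableX.
  by apply: subset_card_le => -[f i] [/= Ff _].
have [q0 Dq0 _] := cover k Kk.
have [s rs] := countable_enumeration cD (ex_intro _ q0 Dq0).
have Ds n : D (s n) by rewrite -rs; exists n.
have [x Kx nx] : exists2 x, K x & forall n, ~ comp (s n) x.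
  apply: compact_Baire => //.
    by move=> n; apply: subcontinuum_closed; case: (hE _ (Ds n)).
  move=> n O oO OK; have [s1 s2 s3] := hE _ (Ds n).
  exact: indecomposable_interior.
have [q Dq cq] := cover x Kx.
by move: Dq; rewrite -rs => -[n _ sn]; apply: (nx n); rewrite sn.
Qed.

End Indecomposable.

(** * Orders with convex subcontinua *)

(** Zorn's lemma for reverse inclusion, to be applied to families of continua, whose
chains have continua as intersections. *)
Lemma minimal_member {T : Type} (F : set (set T)) : F !=set0 ->
  (forall C, C `<=` F -> C !=set0 -> total_on C subset ->
     F (\bigcap_(A in C) A)) ->
  exists2 K, F K & forall A, F A -> A `<=` K -> A = K.
Proof.
move=> [K0 FK0] Fch.
pose P := [set Y : set T | Y = set0 \/ F (~` Y)].
have [A [PA maxA]] : exists A, P A /\ forall B, A `<` B -> ~ P B.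
  apply: Zorn_bigcup => C CP totC.
  pose D := [set A | C (~` A) /\ F A].
  have [D0|D0] := pselect (D !=set0); last first.
    left; apply/seteqP; split => // x [Y CY Yx]; exfalso.
    have [Y0|FY] := CP Y CY; first by move: Yx; rewrite Y0.
    by apply: D0; exists (~` Y); split => //; rewrite setCK.
  right; suff -> : ~` (\bigcup_(Y in C) Y) = \bigcap_(A in D) A.
    apply: Fch => //; first by move=> A [].
    move=> A B [CA _] [CB _].
    have [AB|AB] := totC _ _ CA CB; [right|left] => x hx; apply: contrapT => nx;
      exact: (AB x nx hx).
  apply/seteqP; split => x.
    move=> nx A [CA FA]; apply: contrapT => nAx; apply: nx.
    by exists (~` A).
  move=> Dx [Y CY Yx].
  have [Y0|FY] := CP Y CY; first by move: Yx; rewrite Y0.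
  by have /(_ _)/(_ Yx) := Dx (~` Y); apply; split; rewrite ?setCK.
have FA : F (~` A).
  case: PA => // A0; rewrite A0 setC0.
  have [K0T|K0T] := pselect (K0 = setT); first by rewrite -K0T.
  exfalso; apply: (maxA (~` K0)); last by right; rewrite setCK.
  rewrite A0; split => // /(_ _) K0s; apply: K0T; apply/seteqP; split => // x _.
  by apply: contrapT => /K0s.
exists (~` A) => // B FB BA; apply: contrapT => BnA.
apply: (maxA (~` B)); last by right; rewrite setCK.
split; first by move=> x Ax Bx; exact: (BA x Bx).
move=> BA'; apply: BnA; apply/seteqP; split => //.
by move=> x Ax; apply: contrapT => /BA'.
Qed.

Section ContinuumOrder.
Context {R : realType} {X : metricType R}.
Implicit Types (A K L M : set X).

(** The one property of ultrafilter orders that the construction of the order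
isomorphism rests on is the convexity of subcontinua; it is self-dual. *)
Record continuum_order (le : X -> X -> Prop) : Prop := {
  co_total : forall x y, le x y \/ le y x ;
  co_anti : forall x y, le x y -> le y x -> x = y ;
  co_trans : forall y x z, le x y -> le y z -> le x z ;
  co_convex : forall K a b x, subcontinuum K -> K a -> K b ->
    le a x -> le x b -> K x }.

Lemma continuum_order_dual le : continuum_order le ->
  continuum_order (fun x y => le y x).
Proof.
case=> tot anti trans convex; split.
- by move=> x y; exact: tot.
- by move=> x y ? ?; exact: anti.
- by move=> y x z xy yz; exact: trans yz xy.
- by move=> K a b x sK Ka Kb ax xb; exact: (convex K b a).
Qed.

Definition order_max (le : X -> X -> Prop) A p := A p /\ forall x, A x -> le x p.

Hypothesis cptX : compact [set: X].
Variable B : nat -> set X.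
Hypothesis hB : countable_base B.
Hypothesis sX : suslinean X.

(** A minimal cofinal subcontinuum is indecomposable, hence a point. *)
Lemma subcontinuum_max le K : continuum_order le -> subcontinuum K ->
  exists p, order_max le K p.
Proof.
move=> hle sK.
pose F := [set A | [/\ subcontinuum A, A `<=` K &
  forall x, K x -> exists2 y, A y & le x y]].
have lexx x : le x x by case: (co_total hle x x).
have [||M [sM MK Mcof] minM] := minimal_member (F := F).
- by exists K; split => // x Kx; exists x.
- move=> C CF C0 totC.
  have sI : subcontinuum (\bigcap_(A in C) A).
    by apply: chain_bigcap_subcontinuum => // A /CF[].
  have [A0 CA0] := C0; split => //.
    by move=> x Cx; have [_ AK _] := CF A0 CA0; exact: (AK _ (Cx A0 CA0)).
  move=> x Kx; have [[a Ca] _ _] := sI.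
  have [ax|xa] := co_total hle a x; last by exists a.
  exists x => // A CA; have [sA AK Acof] := CF A CA.
  have [y Ay xy] := Acof x Kx.
  exact: (co_convex hle sA (Ca A CA) Ay).
have [ndM|dM] := pselect (nondegenerate_set M).
  exfalso; apply: (suslinean_decomposable cptX hB sX sM ndM).
  move=> A A' sA sA' AA'.
  have AM : A `<=` M by rewrite -AA' => x; left.
  have A'M : A' `<=` M by rewrite -AA' => x; right.
  have [cA|] := pselect (forall x, K x -> exists2 y, A y & le x y).
    by left; apply: minM => //; split => // x /AM /MK.
  have [cA'|] := pselect (forall x, K x -> exists2 y, A' y & le x y).
    by right; apply: minM => //; split => // x /A'M /MK.
  move=> /existsNP[x /not_implyP[Kx nx]] /existsNP[y /not_implyP[Ky ny]].
  exfalso; have [z [Kz xz yz]] : exists z, [/\ K z, le x z & le y z].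
    by have [xy|yx] := co_total hle x y; [exists y|exists x].
  have [t + zt] := Mcof z Kz; rewrite -AA' => -[At|A't].
  - by apply: ny; exists t => //; exact: co_trans hle _ _ _ yz zt.
  - by apply: nx; exists t => //; exact: co_trans hle _ _ _ xz zt.
have [[p Mp] _ _] := sM; exists p; split; first exact: MK.
move=> x Kx; have [y My xy] := Mcof x Kx.
have -> // : p = y by apply: contrapT => py; apply: dM; exists p, y.
Qed.

(** By convexity, a point of [L] above the last point of the intersection would belong
to all members of the chain, and so would a first point of [L']. *)
Lemma chain_bigcap_cut le L L' (C : set (set X)) : continuum_order le ->
  (forall x, L x \/ L' x) -> (forall x y, L x -> L' y -> le x y /\ x <> y) ->
  C !=set0 -> (forall A, C A -> [/\ subcontinuum A, A `&` L !=set0 & A `&` L' !=set0]) ->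
  total_on C subset -> \bigcap_(A in C) A `<=` L ->
  (exists p, order_max le L p) /\ ~ exists q, order_max (fun x y => le y x) L' q.
Proof.
move=> hle LL' Lle C0 hC totC CL; set K := \bigcap_(A in C) A.
have sK : subcontinuum K.
  by apply: chain_bigcap_subcontinuum => // A /hC[].
have [p [Kp pmax]] := subcontinuum_max hle sK.
split.
  exists p; split; first exact: CL.
  move=> a La; have [//|pa] := co_total hle a p; apply: pmax => A CA.
  have [sA _ [r [Ar L'r]]] := hC A CA.
  apply: (co_convex hle sA (Kp A CA) Ar pa).
  by case: (Lle a r La L'r).
move=> [q [L'q qmin]].
have Kq : K q.
  move=> A CA; have [sA [l [Al Ll]] [r [Ar L'r]]] := hC A CA.
  apply: (co_convex hle sA Al Ar); last exact: qmin.
  by case: (Lle l q Ll L'q).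
by have [_] := Lle q q (CL q Kq) L'q; apply.
Qed.

(** The order has no jumps and no gaps: a continuum which is minimal among those
meeting both sides of a cut would be indecomposable, so some chain of such continua
shrinks to a continuum on one side, whose last point realizes the cut. *)
Lemma continuum_cut le L L' : continuum_order le -> connected [set: X] ->
  (forall x, L x \/ L' x) -> (forall x y, L x -> L' y -> le x y /\ x <> y) ->
  L !=set0 -> L' !=set0 ->
  ((exists p, order_max le L p) /\ ~ exists q, order_max (fun x y => le y x) L' q)
  \/ ((exists q, order_max (fun x y => le y x) L' q) /\ ~ exists p, order_max le L p).
Proof.
move=> hle conX LL' Lle L0 L'0.
have dLL' x : L x -> L' x -> False.
  by move=> Lx L'x; have [_] := Lle x x Lx L'x; apply.
pose F := [set A | [/\ subcontinuum A, A `&` L !=set0 & A `&` L' !=set0]].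
have F0 : F !=set0.
  exists setT; split; rewrite ?setTI //.
  by split => //; have [x _] := L0; exists x.
have [Fch|] := pselect (forall C, C `<=` F -> C !=set0 -> total_on C subset ->
    F (\bigcap_(A in C) A)); last first.
  move=> /existsNP[C /not_implyP[CF /not_implyP[C0 /not_implyP[totC nF]]]].
  have [CL|nCL] := pselect (\bigcap_(A in C) A `<=` L).
    by left; exact: chain_bigcap_cut CL.
  have [CL'|nCL'] := pselect (\bigcap_(A in C) A `<=` L').
    right; apply: (chain_bigcap_cut (continuum_order_dual hle) _ _ C0 _ totC CL').
    - by move=> x; case: (LL' x); [right|left].
    - move=> x y L'x Ly; have [yx nyx] := Lle y x Ly L'x.
      by split => // /esym.
    - by move=> A /CF[].
  exfalso; apply: nF; split.
  - by apply: chain_bigcap_subcontinuum => // A /CF[].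
  - apply: contrapT => h; apply: nCL' => x Cx.
    by case: (LL' x) => // Lx; exfalso; apply: h; exists x.
  - apply: contrapT => h; apply: nCL => x Cx.
    by case: (LL' x) => // Lx; exfalso; apply: h; exists x.
have [K [sK [l [Kl Ll]] [r [Kr L'r]]] minK] := minimal_member F0 Fch.
exfalso; apply: (suslinean_decomposable cptX hB sX sK).
  by exists l, r; split => //; case: (Lle l r Ll L'r).
move=> A A' sA sA' AA'; apply: contrapT => /not_orP[AnK A'nK].
have side D : subcontinuum D -> D `<=` K -> D <> K -> D `<=` L \/ D `<=` L'.
  move=> sD DK DnK; apply: contrapT => /not_orP[DL DL']; apply: DnK.
  apply: minK => //; split => //.
  - apply: contrapT => h; apply: DL' => x Dx.
    by case: (LL' x) => // Lx; exfalso; apply: h; exists x.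
  - apply: contrapT => h; apply: DL => x Dx.
    by case: (LL' x) => // Lx; exfalso; apply: h; exists x.
have AK : A `<=` K by rewrite -AA' => x; left.
have A'K : A' `<=` K by rewrite -AA' => x; right.
have disj : A `&` A' = set0 -> False.
  move=> dAA'; have [_ _ conK] := sK.
  have [|KA|KA'] := connected_sub_closedU conK (subcontinuum_closed sA)
    (subcontinuum_closed sA') dAA'; first by rewrite AA'.
  - by apply: AnK; apply/seteqP.
  - by apply: A'nK; apply/seteqP.
have [AL|AL'] := side A sA AK AnK; have [A'L|A'L'] := side A' sA' A'K A'nK.
- by move: Kr; rewrite -AA' => -[/AL|/A'L] Lr; exact: dLL' L'r.
- by apply: disj; apply/disjoints_subset => x /AL Lx /A'L'; exact: dLL'.
- by apply: disj; apply/disjoints_subset => x /AL' Lx /A'L /dLL'; exact.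
- by move: Kl; rewrite -AA' => -[/AL'|/A'L'] L'l; exact: dLL' L'l.
Qed.

(** A jump would be a cut with a last point below and a first point above. *)
Lemma continuum_order_dense le x y : continuum_order le -> connected [set: X] ->
  le x y -> x <> y -> exists z, [/\ le x z, le z y, x <> z & z <> y].
Proof.
move=> hle conX xy nxy; apply: contrapT => nz.
have lexx z : le z z by case: (co_total hle z z).
pose L := [set z | le z x]; pose L' := [set z | le y z].
have mL : order_max le L x by split => //; exact: lexx.
have mL' : order_max (fun x y => le y x) L' y by split => //; exact: lexx.
have [||||[_]|[_]] := @continuum_cut le L L' hle conX.
- move=> z; have [zx|xz] := co_total hle z x; first by left.
  have [zy|yz] := co_total hle z y; last by right.
  have [->|zx] := pselect (z = x); first by left; exact: lexx.
  have [->|zy'] := pselect (z = y); first by right; exact: lexx.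
  by exfalso; apply: nz; exists z; split => // /esym.
- move=> u v ux yv; have uy := co_trans hle ux xy.
  split; first exact: co_trans hle _ _ _ uy yv.
  move=> uv; apply: nxy; apply: (co_anti hle) => //.
  by apply: co_trans hle _ _ _ yv _; rewrite -uv.
- by exists x; exact: lexx.
- by exists y; exact: lexx.
- by apply; exists y.
- by apply; exists x.
Qed.

(** Among the small continua of a family which no small continuum avoids, one meets
[K] without containing it; by convexity one of its two end points lies in [K]. *)
Lemma countable_set_meeting_subcontinua le : continuum_order le ->
  exists2 S : set X, countable S &
    forall K, subcontinuum K -> nondegenerate_set K -> S `&` K !=set0.
Proof.
move=> hle.
pose P (k : nat) := [set M : set X | [/\ subcontinuum M, nondegenerate_set M &
  forall x y, M x -> M y -> mdist x y < k.+1%:R^-1]].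
have /choice[F hF] k : exists F : set (set X), [/\ countable F, F `<=` P k &
    forall K, P k K -> exists2 A, F A & A `&` K !=set0].
  by apply: suslinean_meeting_family => // M [].
have [[x0 _]|nX] := pselect ([set: X] !=set0); last first.
  exists set0 => // K [[x _] _ _]; exfalso; apply: nX; by exists x.
pose mx A := xget x0 (order_max le A).
pose mn A := xget x0 (order_max (fun x y => le y x) A).
have hdle := continuum_order_dual hle.
have mxP A : subcontinuum A -> order_max le A (mx A).
  by move=> sA; have [p Ap] := subcontinuum_max hle sA; exact: xgetI Ap.
have mnP A : subcontinuum A -> order_max (fun x y => le y x) A (mn A).
  by move=> sA; have [p Ap] := subcontinuum_max hdle sA; exact: xgetI Ap.
exists (\bigcup_k ((mx @` F k) `|` (mn @` F k))).
  apply: bigcup_countable => // k _; have [cF _ _] := hF k.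
  rewrite -bigcup2E; apply: bigcup_countable => // -[|[|?]] //= _;
    exact: (sub_countable (card_image_le _ _)).
move=> K sK ndK; have [u [v [Ku Kv uv]]] := ndK.
have d0 : 0 < mdist u v by rewrite mdist_gt0; apply/eqP.
have [k kuv] : exists k : nat, k.+1%:R^-1 < mdist u v.
  have [k _ hk] := near_infty_natSinv_lt (PosNum d0).
  by exists k; exact: (hk k (leqnn k)).
have k0 : 0 < (k.+1%:R^-1 : R) by rewrite invr_gt0 ltr0n.
have [|M [sM ndM Mu MK Mb]] :=
    small_subcontinuum cptX sK ndK Ku (e := k.+1%:R^-1 / 2).
  by rewrite divr_gt0.
have [_ FP Fmeet] := hF k.
have [|A FA [f [Af Mf]]] := Fmeet M.
  split => // y z /Mb /ballP uy /Mb /ballP uz.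
  apply: le_lt_trans (metric_triangle y u z) _.
  by rewrite (metric_sym y u) [ltRHS]splitr; exact: ltrD.
have [sA _ Asmall] := FP A FA.
have [m Km nAm] : exists2 m, K m & ~ A m.
  apply: contrapT => h.
  have KA : K `<=` A by move=> z Kz; apply: contrapT => nz; apply: h; exists z.
  by have := lt_trans kuv (Asmall u v (KA u Ku) (KA v Kv)); rewrite ltxx.
have [Ap pmax] := mxP A sA; have [Aq qmin] := mnP A sA.
have [fm|mf] := co_total hle f m.
- exists (mx A); split; first by exists k => //; left; exists A.
  apply: (co_convex hle sK (MK f Mf) Km); first exact: pmax.
  have [//|mp] := co_total hle (mx A) m.
  by case: nAm; exact: (co_convex hle sA Af Ap).
- exists (mn A); split; first by exists k => //; right; exists A.
  apply: (co_convex hle sK Km (MK f Mf)); last exact: qmin.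
  have [//|mp] := co_total hle m (mn A).
  by case: nAm; exact: (co_convex hle sA Aq Af).
Qed.

(** A small continuum around a point between [x] and [y] contains neither of them, so
by convexity it lies between them. *)
Lemma order_dense_of_meeting le (S : set X) x y : continuum_order le ->
  connected [set: X] ->
  (forall K, subcontinuum K -> nondegenerate_set K -> S `&` K !=set0) ->
  le x y -> x <> y ->
  exists s, S s /\ [/\ le x s, le s y, x <> s & s <> y].
Proof.
move=> hle conX hS xy nxy.
have [c [xc cy nxc ncy]] := continuum_order_dense hle conX xy nxy.
pose e := Num.min (mdist c x) (mdist c y).
have sT : subcontinuum [set: X] by split => //; exists x.
have ndT : nondegenerate_set [set: X] by exists x, y.
have e0 : 0 < e.
  by rewrite lt_min !mdist_gt0; apply/andP; split; apply/eqP => // /esym.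
have [M [sM ndM Mc _ Mb]] := small_subcontinuum cptX sT ndT (I : setT c) e0.
have nMx : ~ M x by move=> /Mb /ballP; rewrite lt_min ltxx.
have nMy : ~ M y by move=> /Mb /ballP; rewrite lt_min ltxx andbF.
have [s [Ss Ms]] := hS M sM ndM; exists s; split => //; split.
- have [//|sx] := co_total hle x s.
  by case: nMx; exact: (co_convex hle sM Ms Mc).
- have [//|ys] := co_total hle s y.
  by case: nMy; exact: (co_convex hle sM Mc Ms).
- by move=> xs; apply: nMx; rewrite xs.
- by move=> sy; apply: nMy; rewrite -sy.
Qed.

End ContinuumOrder.

(** * Cantor's characterization of the unit interval *)

Section CantorIsomorphism.
Context {R : realType} {d : Order.disp_t} {T : orderType d}.
Implicit Types (x y p : T) (s : nat -> T) (f : nat -> R).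

Lemma bigmax0_spec f (P : pred nat) n (z := \big[Num.max/0]_(i < n | P i) f i) :
  [/\ 0 <= z, forall i, (i < n)%N -> P i -> f i <= z &
     z = 0 \/ exists i, [/\ (i < n)%N, P i & z = f i]].
Proof.
split.
- by rewrite /z; elim/big_rec: _ => // i x _ x0; rewrite le_max x0 orbT.
- by move=> i lin Pi; exact: (le_bigmax_cond _ (fun j : 'I_n => f j) (j := Ordinal lin)).
- rewrite /z; elim/big_rec: _ => [|i x Pi IH]; first by left.
  by have [_|_] := leP (f i) x => //; right; exists i.
Qed.

Lemma bigmin1_spec f (P : pred nat) n (z := \big[Num.min/1]_(i < n | P i) f i) :
  [/\ z <= 1, forall i, (i < n)%N -> P i -> z <= f i &
     z = 1 \/ exists i, [/\ (i < n)%N, P i & z = f i]].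
Proof.
split.
- by rewrite /z; elim/big_rec: _ => // i x _ x0; rewrite ge_min x0 orbT.
- by move=> i lin Pi; exact: (bigmin_le_cond _ (fun j : 'I_n => f j) (j := Ordinal lin)).
- rewrite /z; elim/big_rec: _ => [|i x Pi IH]; first by left.
  by have [_|_] := leP (f i) x => //; right; exists i.
Qed.

Definition lower_value s f n := \big[Num.max/0]_(i < n | (s i <= s n)%O) f i.
Definition upper_value s f n := \big[Num.min/1]_(i < n | (s n <= s i)%O) f i.

Fixpoint midpoint_prefix s n : seq R :=
  if n is m.+1 then
    let v := nth 0 (midpoint_prefix s m) in
    rcons (midpoint_prefix s m) ((lower_value s v m + upper_value s v m) / 2)
  else [::].

(** The [n]-th point of the enumeration [s] is sent to the midpoint of the values of
its nearest neighbours among the earlier points. *)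
Definition midpoint_map s n : R := nth 0 (midpoint_prefix s n.+1) n.

Lemma size_midpoint_prefix s n : size (midpoint_prefix s n) = n.
Proof. by elim: n => //= n IH; rewrite size_rcons IH. Qed.

Lemma nth_midpoint_prefix s n i : (i < n)%N ->
  nth 0 (midpoint_prefix s n) i = midpoint_map s i.
Proof.
elim: n => // n IH; rewrite ltnS leq_eqVlt => /orP[/eqP -> //|lin].
by rewrite /= nth_rcons size_midpoint_prefix lin IH.
Qed.

Lemma midpoint_mapE s n (f := midpoint_map s) :
  f n = (lower_value s f n + upper_value s f n) / 2.
Proof.
rewrite /f {1}/midpoint_map /= nth_rcons size_midpoint_prefix ltnn eqxx.
congr ((_ + _) / 2); apply: eq_bigr => i _; exact: nth_midpoint_prefix.
Qed.

Lemma midpoint_map_order s n (f := midpoint_map s) : 0 < f n < 1 /\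
  forall i, (i < n)%N -> [/\ (s i < s n)%O -> f i < f n,
    (s n < s i)%O -> f n < f i & s i = s n -> f i = f n].
Proof.
elim/ltn_ind: n => n IH.
have fnE : f n = (lower_value s f n + upper_value s f n) / 2 by exact: midpoint_mapE.
rewrite fnE {fnE}.
have mono i j : (i < n)%N -> (j < n)%N -> (s i < s j)%O -> f i < f j.
  move=> lin ljn sij; case: (ltngtP i j) => [ij|ji|ij].
  - by have [_ /(_ i ij)[h _ _]] := IH j ljn; exact: h.
  - by have [_ /(_ j ji)[_ h _]] := IH i lin; exact: h.
  - by move: sij; rewrite ij ltxx.
have meq i j : (i < n)%N -> (j < n)%N -> s i = s j -> f i = f j.
  move=> lin ljn sij; case: (ltngtP i j) => [ij|ji|-> //].
  - by have [_ /(_ i ij)[_ _ h]] := IH j ljn; exact: h.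
  - by have [_ /(_ j ji)[_ _ h]] := IH i lin; rewrite h.
have mle i j : (i < n)%N -> (j < n)%N -> (s i <= s j)%O -> f i <= f j.
  by move=> lin ljn; rewrite le_eqVlt => /orP[/eqP/meq ->//|/mono/ltW]; exact.
have [lo0 lo_ub lo_att] := bigmax0_spec f (fun i => (s i <= s n)%O) n.
have [hi1 hi_lb hi_att] := bigmin1_spec f (fun i => (s n <= s i)%O) n.
rewrite -/(lower_value s f n) in lo0 lo_ub lo_att *.
rewrite -/(upper_value s f n) in hi1 hi_lb hi_att *.
set lo := lower_value s f n in lo0 lo_ub lo_att *.
set hi := upper_value s f n in hi1 hi_lb hi_att *.
have f01 i : (i < n)%N -> 0 < f i < 1 by move=> /IH[].
(* For a point enumerated before, both bounds are its earlier value. *)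
have [[j [ljn sjn]]|nj] := pselect (exists j, (j < n)%N /\ s j = s n).
  have fj := f01 j ljn.
  have loE : lo = f j.
    apply/eqP; rewrite eq_le lo_ub ?sjn// andbT.
    by case: lo_att => [->|[i [lin sin ->]]]; [lra|apply: mle => //; rewrite sjn].
  have hiE : hi = f j.
    apply/eqP; rewrite eq_le hi_lb ?sjn//=.
    by case: hi_att => [->|[i [lin sin ->]]]; [lra|apply: mle => //; rewrite sjn].
  have -> : (lo + hi) / 2 = f j by rewrite loE hiE; lra.
  split=> // i lin; rewrite -sjn; split; first exact: mono.
    exact: mono.
  exact: meq.
have lohi : lo < hi.
  have slt i : (i < n)%N -> (s i <= s n)%O -> (s i < s n)%O.
    move=> lin; rewrite lt_neqAle => ->; rewrite andbT.
    by apply/eqP => sin; apply: nj; exists i.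
  have sgt i : (i < n)%N -> (s n <= s i)%O -> (s n < s i)%O.
    move=> lin; rewrite lt_neqAle => ->; rewrite andbT.
    by apply/eqP => sin; apply: nj; exists i.
  case: lo_att => [->|[i [lin sin ->]]]; case: hi_att => [->|[j [ljn sjn ->]]] //.
  - by have := f01 j ljn; lra.
  - by have := f01 i lin; lra.
  - by apply: mono => //; apply: lt_le_trans sjn; exact: slt.
split; first by lra.
move=> i lin; split.
- by move=> /ltW /(lo_ub i lin); lra.
- by move=> /ltW /(hi_lb i lin); lra.
- by move=> sin; exfalso; apply: nj; exists i.
Qed.

Lemma midpoint_map01 s n : 0 < midpoint_map s n < 1.
Proof. by case: (midpoint_map_order s n). Qed.

Lemma midpoint_map_lt s i j : (s i < s j)%O -> midpoint_map s i < midpoint_map s j.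
Proof.
move=> sij; case: (ltngtP i j) => [ij|ji|ij].
- by have [_ /(_ i ij)[h _ _]] := midpoint_map_order s j; exact: h.
- by have [_ /(_ j ji)[_ h _]] := midpoint_map_order s i; exact: h.
- by move: sij; rewrite ij ltxx.
Qed.

Lemma midpoint_map_le s i j : (s i <= s j)%O -> midpoint_map s i <= midpoint_map s j.
Proof.
rewrite le_eqVlt => /orP[/eqP sij|/midpoint_map_lt/ltW//].
case: (ltngtP i j) => [ij|ji|-> //].
- by have [_ /(_ i ij)[_ _ ->]] := midpoint_map_order s j.
- by have [_ /(_ j ji)[_ _ ->]] := midpoint_map_order s i.
Qed.

(** If the interval from [u] to [v] were missed, the first point of the enumeration
between the best approximations from both sides would be sent into the gap, at the
middle of it up to the error of these approximations. *)
Lemma midpoint_map_dense s (m M : T) (u v : R) (f := midpoint_map s) :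
  (m < M)%O -> (forall n, (m < s n < M)%O) ->
  (forall x y, (x < y)%O -> exists n, (x < s n < y)%O) ->
  0 <= u -> u < v -> v <= 1 -> exists n, u < f n < v.
Proof.
move=> mM sb sd u0 uv v1; apply: contrapT => gap.
have gapP n : f n <= u \/ v <= f n.
  have [|un] := leP (f n) u; first by left.
  have [|nv] := leP v (f n); first by right.
  by exfalso; apply: gap; exists n; rewrite un nv.
pose A := [set z | z = 0 \/ exists2 n, z = f n & f n <= u].
pose B := [set z | z = 1 \/ exists2 n, z = f n & v <= f n].
have ubA : ubound A u by move=> z [->|[n ->]].
have lbB : lbound B v by move=> z [->|[n ->]].
have A0 : A 0 by left.
have B1 : B 1 by left.
have supA : has_sup A by split; [exists 0|exists u].
have infB : has_inf B by split; [exists 1|exists v].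
have au : sup A <= u by apply: ge_sup => //; exists 0.
have vb : v <= inf B by apply: lb_le_inf => //; exists 1.
pose e := inf B - sup A.
have e0 : 0 < e by rewrite /e; lra.
have [a Aa ae] := sup_adherent e0 supA.
have [b Bb be] := inf_adherent e0 infB.
have [N Na Nb] : exists2 N, a <= \big[Num.max/0]_(i < N | f i <= u) f i
    & \big[Num.min/1]_(i < N | v <= f i) f i <= b.
  have [i hi] : exists i, forall N, (i < N)%N ->
      a <= \big[Num.max/0]_(i < N | f i <= u) f i.
    case: Aa => [->|[i -> fiu]].
      by exists 0%N => N _; have [] := bigmax0_spec f (fun i => f i <= u) N.
    exists i => N iN; have [_ h _] := bigmax0_spec f (fun i => f i <= u) N.
    exact: h.
  have [j hj] : exists j, forall N, (j < N)%N ->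
      \big[Num.min/1]_(i < N | v <= f i) f i <= b.
    case: Bb => [->|[j -> fjv]].
      by exists 0%N => N _; have [] := bigmin1_spec f (fun i => v <= f i) N.
    exists j => N jN; have [_ h _] := bigmin1_spec f (fun i => v <= f i) N.
    exact: h.
  exists (maxn i j).+1; first by apply: hi; rewrite ltnS leq_maxl.
  by apply: hj; rewrite ltnS leq_maxr.
have [a0' a_ub a_att] := bigmax0_spec f (fun i => f i <= u) N.
have [b1' b_lb b_att] := bigmin1_spec f (fun i => v <= f i) N.
set a' := \big[Num.max/0]_(i < N | f i <= u) f i in Na a0' a_ub a_att.
set b' := \big[Num.min/1]_(i < N | v <= f i) f i in Nb b1' b_lb b_att.
(* [x] and [y] are points with values [a'] and [b'], or else the end points [m] and
   [M] when these values are [0] and [1]. *)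
have [x [xa xlt xatt]] : exists x, [/\ forall i, (i < N)%N -> f i <= u -> (s i <= x)%O,
    x = m \/ (exists2 i, x = s i & f i <= u) &
    forall n, (N <= n)%N -> (x < s n)%O -> a' <= lower_value s f n].
  case: a_att => [a'0|[i [iN fiu a'i]]].
    exists m; split; last 2 first.
    - by left.
    - move=> n _ _; rewrite a'0.
      by have [] := bigmax0_spec f (fun i => (s i <= s n)%O) n.
    move=> i iN fiu; have := a_ub i iN fiu.
    by rewrite a'0 [f i <= 0]leNgt; case/andP: (midpoint_map01 s i); rewrite -/f => ->.
  exists (s i); split; last 2 first.
  - by right; exists i.
  - move=> n Nn sin; rewrite a'i.
    have [_ h _] := bigmax0_spec f (fun i => (s i <= s n)%O) n.
    by apply: h; [exact: leq_trans Nn|exact: ltW].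
  move=> j jN fju; rewrite leNgt; apply/negP => /midpoint_map_lt.
  by rewrite -/f ltNge -a'i a_ub.
have [y [yb ygt yatt]] : exists y, [/\ forall i, (i < N)%N -> v <= f i -> (y <= s i)%O,
    y = M \/ (exists2 i, y = s i & v <= f i) &
    forall n, (N <= n)%N -> (s n < y)%O -> upper_value s f n <= b'].
  case: b_att => [b'1|[i [iN fiv b'i]]].
    exists M; split; last 2 first.
    - by left.
    - move=> n _ _; rewrite b'1.
      by have [] := bigmin1_spec f (fun i => (s n <= s i)%O) n.
    move=> i iN fiv; have := b_lb i iN fiv.
    by rewrite b'1 [1 <= f i]leNgt; case/andP: (midpoint_map01 s i); rewrite -/f => _ ->.
  exists (s i); split; last 2 first.
  - by right; exists i.
  - move=> n Nn sin; rewrite b'i.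
    have [_ h _] := bigmin1_spec f (fun i => (s n <= s i)%O) n.
    by apply: h; [exact: leq_trans Nn|exact: ltW].
  move=> j jN fjv; rewrite leNgt; apply/negP => /midpoint_map_lt.
  by rewrite -/f ltNge -b'i b_lb.
have xy : (x < y)%O.
  case: xlt => [->|[i -> fiu]]; case: ygt => [->|[j -> fjv]] //.
  - by case/andP: (sb j).
  - by case/andP: (sb i).
  - rewrite ltNge; apply/negP => /midpoint_map_le; rewrite -/f.
    by apply/negP; rewrite -ltNge; move: fiu fjv uv; clear; lra.
have := sd x y xy; move=> /(@ex_minnP (fun n => (x < s n < y)%O))[n /andP[xn ny] nmin].
have Nn : (N <= n)%N.
  rewrite leqNgt; apply/negP => nN; have [fnu|fnv] := gapP n.
    by have := lt_le_trans xn (xa n nN fnu); rewrite ltxx.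
  by have := lt_le_trans ny (yb n nN fnv); rewrite ltxx.
have lo_le : A (lower_value s f n).
  have [_ _] := bigmax0_spec f (fun i => (s i <= s n)%O) n.
  rewrite -/(lower_value s f n) => -[->//|[i [lin sin ->]]].
  right; exists i => //.
  have six : (s i <= x)%O.
    rewrite leNgt; apply/negP => xi; suff : (n <= i)%N by rewrite leqNgt lin.
    by apply: nmin; rewrite xi (le_lt_trans sin).
  case: xlt => [xm|[k xk fku]].
    by move: six; rewrite xm leNgt; case/andP: (sb i) => ->.
  by apply: le_trans fku; apply: midpoint_map_le; rewrite -xk.
have hi_ge : B (upper_value s f n).
  have [_ _] := bigmin1_spec f (fun i => (s n <= s i)%O) n.
  rewrite -/(upper_value s f n) => -[->//|[i [lin sin ->]]].
  right; exists i => //.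
  have yi : (y <= s i)%O.
    rewrite leNgt; apply/negP => iy; suff : (n <= i)%N by rewrite leqNgt lin.
    by apply: nmin; rewrite iy (lt_le_trans xn).
  case: ygt => [yM|[k yk fkv]].
    by move: yi; rewrite yM leNgt; case/andP: (sb i) => _ ->.
  by apply: (le_trans fkv); apply: midpoint_map_le; rewrite -yk.
have fn := midpoint_mapE s n; rewrite -/f in fn.
have h1 : lower_value s f n <= sup A by apply: ub_le_sup => //; exists u.
have h2 : inf B <= upper_value s f n by apply: ge_inf => //; exists v.
have h3 := xatt n Nn xn; have h4 := yatt n Nn ny.
have [fnu|fnv] := gapP n.
  have : f n <= sup A by apply: ub_le_sup; [exists u|right; exists n].
  by move: ae fn Na h2 h3; rewrite /e; clear; lra.
have : inf B <= f n by apply: ge_inf; [exists v|right; exists n].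
by move: be fn Nb h1 h4; rewrite /e; clear; lra.
Qed.

(** Cantor's theorem: the values of the midpoint map are dense in the unit interval,
so that it extends to an isomorphism by taking suprema. *)
Lemma order_isomorphic_of_separable (S : set T) (m M : T) : (m < M)%O ->
  (forall x, (m <= x <= M)%O) -> countable S ->
  (forall x y, (x < y)%O -> exists2 z, S z & (x < z < y)%O) ->
  (forall A : set T, A !=set0 -> exists p, isLub A p) ->
  order_isomorphic_to_unit_interval R T.
Proof.
move=> mM bnd cS dS lubT.
pose S' := [set z | S z /\ (m < z < M)%O].
have cS' : countable S'.
  by apply: (sub_countable _ cS); apply: subset_card_le => z [].
have S'0 : S' !=set0.
  by have [z Sz mz] := dS m M mM; exists z.
have [s rs] := countable_enumeration cS' S'0.
have sb n : (m < s n < M)%O.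
  by have [] : S' (s n) by rewrite -rs; exists n.
have sd x y : (x < y)%O -> exists n, (x < s n < y)%O.
  move=> xy; have [z Sz /andP[xz zy]] := dS x y xy.
  have : S' z.
    split => //; have /andP[mx _] := bnd x; have /andP[_ yM] := bnd y.
    by rewrite (le_lt_trans mx) ?(lt_le_trans zy).
  by rewrite -rs => -[n _ sn]; exists n; rewrite sn xz.
pose f := midpoint_map s.
have fdense u v : 0 <= u -> u < v -> v <= 1 -> exists n, u < f n < v.
  exact: midpoint_map_dense mM sb sd.
pose E x := [set z | z = 0 \/ exists2 n, z = f n & (s n <= x)%O].
have E0 x : E x 0 by left.
have f01 n : 0 < f n < 1 by exact: midpoint_map01.
have E1 x : ubound (E x) 1 by move=> z [->|[n -> _]] //; have := f01 n; lra.
have supE x : has_sup (E x) by split; [exists 0|exists 1].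
pose F x := sup (E x).
have F0 x : 0 <= F x by apply: ub_le_sup; [exists 1|].
have F1 x : F x <= 1 by apply: ge_sup => //; exists 0.
have fF n x : (s n <= x)%O -> f n <= F x.
  by move=> snx; apply: ub_le_sup; [exists 1|right; exists n].
have Ff n x : (x <= s n)%O -> F x <= f n.
  move=> xsn; apply: ge_sup; first by exists 0.
  move=> z [->|[k -> skx]]; first by have := f01 n; lra.
  by apply: midpoint_map_le; exact: le_trans skx xsn.
have Flt x y : (x < y)%O -> F x < F y.
  move=> xy; have [i /andP[xi iy]] := sd x y xy.
  have [j /andP[ij jy]] := sd (s i) y iy.
  apply: (le_lt_trans (Ff i x (ltW xi))); apply: lt_le_trans (fF j y (ltW jy)).
  exact: midpoint_map_lt.
have Fle x y : (x <= y)%O -> F x <= F y.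
  by rewrite [(x <= y)%O]le_eqVlt => /predU1P[->//|/Flt/ltW].
exists F; split; last first.
  move=> x y; split; first exact: Fle.
  by move=> Fxy; rewrite leNgt; apply/negP => /Flt; rewrite ltNge Fxy.
split.
- by move=> x _; rewrite /= in_itv /= F0 F1.
- move=> x y _ _ Fxy; apply/eqP; rewrite eq_le !leNgt; apply/andP.
  by split; apply/negP => /Flt; rewrite Fxy ltxx.
- move=> t; rewrite /= in_itv /= => /andP[t0 t1].
  pose A := [set z : T | z = m \/ exists2 n, z = s n & f n <= t].
  have [p [Ap pA]] : exists p, isLub A p by apply: lubT; exists m; left.
  exists p => //; apply/eqP; rewrite eq_le; apply/andP; split.
    apply: ge_sup; first by exists 0.
    move=> z [-> //|[n -> snp]]; rewrite leNgt; apply/negP => tfn.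
    have /andP[_ /ltW fn1] := f01 n.
    have [k /andP[tk kn]] := fdense t (f n) t0 tfn fn1.
    have skn : (s k < s n)%O.
      by rewrite ltNge; apply/negP => /midpoint_map_le; rewrite -/f leNgt kn.
    suff /pA : ubound A (s k) by rewrite leNgt (lt_le_trans skn).
    move=> y [->|[l -> flt]]; first by case/andP: (sb k) => /ltW.
    rewrite leNgt; apply/negP => /midpoint_map_lt; rewrite -/f; lra.
  rewrite leNgt; apply/negP => Fpt.
  have [k /andP[pk kt]] := fdense (F p) t (F0 p) Fpt t1.
  have : (s k <= p)%O by apply: Ap; right; exists k => //; exact: ltW.
  by move=> /fF; rewrite leNgt pk.
Qed.

End CantorIsomorphism.

(** * Ultrafilter orders have convex subcontinua *)

Section ChainOrder.
Context {R : realType} {X : metricType R}.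
Implicit Types (K : set X) (d : seq (set X)).

(** Removing a link from a chain separates the earlier links from the later ones. *)
Lemma connected_meets_link d K i m l : is_chain d -> covers d -> connected K ->
  (i <= m)%N -> (m <= l)%N -> (l < size d)%N ->
  nth set0 d i `&` K !=set0 -> nth set0 d l `&` K !=set0 ->
  nth set0 d m `&` K !=set0.
Proof.
move=> [od hd] cd conK im ml ld [a [ia Ka]] [b [lb Kb]].
apply: contrapT => mK.
have nm z : K z -> ~ nth set0 d m z by move=> Kz mz; apply: mK; exists z.
pose A := \bigcup_(k in [set k | (k < m)%N]) nth set0 d k.
pose B := \bigcup_(k in [set k | (m < k)%N /\ (k < size d)%N]) nth set0 d k.
have AB : A `&` B = set0.
  apply/disjoints_subset => z [k /= km kz] [k' [/= mk' k'd] k'z].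
  have : (`|k - k'| <= 1)%N by apply/hd; [lia|lia|exists z].
  by lia.
have oA : open A by apply: bigcup_open => k /= km; apply: od; lia.
have oB : open B by apply: bigcup_open => k [_ kd]; exact: od.
have KAB : K `<=` A `|` B.
  move=> z Kz; have : [set: X] z by [].
  rewrite -cd => -[k /= kd kz].
  have [km|mk|km] := ltngtP k m; [by left; exists k|by right; exists k|].
  by exfalso; apply: (nm z Kz); rewrite -km.
have Aa : A a.
  exists i => //=; rewrite ltn_neqAle im andbT; apply/eqP => iem.
  by apply: (nm a Ka); rewrite -iem.
have Bb : B b.
  exists l => //=; split => //; rewrite ltn_neqAle ml andbT; apply/eqP => iem.
  by apply: (nm b Kb); rewrite iem.
have [KA|KB] := connected_sub_openU conK oA oB AB KAB.
- by have : (A `&` B) b; [split => //; exact: KA|rewrite AB].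
- by have : (A `&` B) a; [split => //; exact: KB|rewrite AB].
Qed.

Variables (D : nat -> seq (set X)) (U : set_system nat).
Hypotheses (hD : chain_sequence D) (hU : nonprincipal_ultrafilter U).

Lemma small_mesh_ball n (e : R) i x : (mesh (D n) < e%:E)%E ->
  (i < size (D n))%N -> nth set0 (D n) i x -> nth set0 (D n) i `<=` ball x e.
Proof.
move=> me iD ix z iz; apply/ballP; rewrite -lte_fin.
exact: le_lt_trans (Defs.chn_dist (conj iD ix) (conj iD iz)) me.
Qed.

(** A point outside of a continuum [K] lies, once the mesh is small, in links that do
not meet [K], and the links meeting [K] are consecutive. *)
Lemma ultra_continuum_order : continuum_order (ultra_le D U).
Proof.
split.
- by move=> x y; have /orP[/asboolP|/asboolP] := ultra_le_total hD hU x y; [left|right].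
- move=> x y xy yx; apply: (ultra_le_anti hD hU).
  by apply/andP; split; apply/asboolP.
- move=> y x z xy yz; apply/asboolP.
  by apply: (ultra_le_trans hD hU (y := y)); apply/asboolP.
move=> K a b x sK Ka Kb ax xb; apply: contrapT => nKx.
have [e e0 eK] := open_ball_sub (closed_openC (subcontinuum_closed sK)) nKx.
have UF : ProperFilter U by case: hU => -[].
have : U ([set n | (mesh (D n) < e%:E)%E] `&`
    ([set n | chain_le (D n) a x] `&` [set n | chain_le (D n) x b])).
  by apply: filterI; [exact: ultra_mesh_lt|exact: filterI].
move=> /filter_ex[n [/= me [[i [j [ij jD ai xj]]] [k [l [kl lD xk bl]]]]]].
have [chD cD] := (chain_seq_chain hD n, chain_seq_covers hD n).
have far t : (t < size (D n))%N -> nth set0 (D n) t x ->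
    ~ (nth set0 (D n) t `&` K !=set0).
  move=> tD tx [z [tz Kz]].
  by have /eK := small_mesh_ball me tD tx tz; apply.
have nb : (`|j - k| <= 1)%N.
  have [_ h] := chD; apply/h => //; first exact: leq_ltn_trans lD.
  by exists x.
have [_ _ conK] := sK.
have iK : nth set0 (D n) i `&` K !=set0 by exists a.
have lK : nth set0 (D n) l `&` K !=set0 by exists b.
have kD : (k < size (D n))%N by exact: leq_ltn_trans lD.
have [jl|lj] := leqP j l.
  exact: (far j jD xj (connected_meets_link chD cD conK ij jl lD iK lK)).
have kl' : k = l by lia.
by apply: (far k kD xk); rewrite kl'.
Qed.

Definition link_base (m : nat) : set X :=
  if unpickle m is Some (n, i) then nth set0 (D n) i else set0.

Lemma link_base_countable_base : countable_base link_base.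
Proof.
split.
  rewrite /link_base => m; case: unpickle => [[n i]|]; last exact: open0.
  have [iD|iD] := ltnP i (size (D n)); last by rewrite nth_default//; exact: open0.
  by have [h _] := chain_seq_chain hD n; exact: h.
move=> x e e0; have UF : ProperFilter U by case: hU => -[].
have /filter_ex[n /= me] := ultra_mesh_lt hD hU e0.
have : [set: X] x by [].
rewrite -(chain_seq_covers hD n) => -[i /= iD ix].
exists (pickle (n, i)); rewrite /link_base pickleK; split => //.
exact: small_mesh_ball.
Qed.

End ChainOrder.

(** * Suslinean continua, the unit interval and the countable chain condition *)

Lemma countable_inj_preimage {T U : Type} (A : set T) (B : set U) (g : T -> U) :
  countable B -> (forall x, A x -> B (g x)) ->
  (forall x y, A x -> A y -> g x = g y -> x = y) -> countable A.
Proof.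
move=> /countable_injP[h hinj] gAB ginj; apply/countable_injP.
exists (h \o g) => x y; rewrite !inE => Ax Ay /hinj; rewrite !inE => hxy.
by apply: ginj => //; apply: hxy; exact: gAB.
Qed.

Lemma disjoint_meeting_countable {T : choiceType} (Q : set T) (F : set (set T)) :
  countable Q -> trivIset F id -> (forall A, F A -> A `&` Q !=set0) ->
  countable F.
Proof.
move=> cQ tF FQ; have [[A0 FA0]|nF] := pselect (F !=set0); last first.
  by rewrite (_ : F = set0)//; apply/seteqP; split => // A FA; apply: nF; exists A.
have [q0 _] := FQ A0 FA0.
pose g (A : set T) := xget q0 (A `&` Q).
have gP A : F A -> (A `&` Q) (g A) by move=> /FQ[q Aq]; exact: xgetI Aq.
apply: (countable_inj_preimage (g := g) cQ) => [A /gP[]//|A B FA FB gAB].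
apply: tF => //; exists (g A); have [? _] := gP A FA; split => //.
by rewrite gAB; have [] := gP B FB.
Qed.

Section OrderTopologyCcc.
Context {R : realType} {d : Order.disp_t} {T : orderType d}.
Notation oT := (order_topology T).

(** Going down from a point of [O] one finds a rational value before leaving [O], be
it [0] at the first point; only the lower end of an interval around the
point matters. *)
Lemma order_iso_dense_point (f : T -> R) (O : set oT) :
  set_bij [set: T] `[0, 1] f -> (forall x y : T, (x <= y)%O <-> f x <= f y) ->
  open O -> O !=set0 -> exists2 x, O x & exists q : rat, f x = ratr q.
Proof.
move=> [fT _ fsurj] fle oO [x Ox].
have flt y z : f y < f z -> (y < z)%O.
  by move=> fyz; rewrite ltNge; apply/negP => /fle; rewrite leNgt fyz.
have surj t : 0 <= t <= 1 -> exists y, f y = t.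
  by move=> t01; have [|y _ yt] := fsurj t; [rewrite /= in_itv|exists y].
have f01 y : 0 <= f y <= 1.
  by have := fT y I; rewrite /= in_itv.
have : nbhs (x : oT) O by apply: open_nbhs_nbhs.
rewrite order_nbhs_itv => -[i [oi xi] iO].
case: i oi xi iO => l r oi xi iO.
have [y [yr [q fyq]] yl] : exists2 y : T, (y <= x)%O /\ (exists q : rat, f y = ratr q) &
    (l <= BLeft y)%O.
  case: l oi xi iO => [bl a|bl] oi xi iO.
    have {oi} bF : bl = false by exact: itv_open_ends_lside oi.
    have : (a < x)%O.
      by move: xi; rewrite bF itv_boundlr => /andP[+ _]; rewrite bnd_simp.
    have [/flt|] := ltP (f x) (f a); first by move=> /lt_trans h /h; rewrite ltxx.
    rewrite le_eqVlt => /predU1P[fax|fax] ax.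
      by exfalso; move: ax; rewrite ltNge => /negP; apply; apply/fle; rewrite fax.
    have [q /andP[aq qx]] := rat_in_itvoo fax.
    have [|y fy] := surj (ratr q).
      have /andP[fa0 _] := f01 a; have /andP[_ fx1] := f01 x.
      by rewrite (le_trans fa0 (ltW aq)) (le_trans (ltW qx) fx1).
    exists y; first split.
    - by apply: ltW; apply: flt; rewrite fy.
    - by exists q.
    - have : (a < y)%O by apply: flt; rewrite fy.
      by rewrite bF bnd_simp.
  have [|y fy] := surj 0; first by rewrite lexx ler01.
  exists y; first split.
    by apply/fle; rewrite fy; case/andP: (f01 x).
    by exists 0; rewrite fy rmorph0.
  by have -> : bl = true by exact: itv_open_ends_linfty oi.
exists y; last by exists q.
apply: iO; rewrite /= itv_boundlr yl /=.
by move: xi; rewrite itv_boundlr => /andP[_]; apply: le_trans; rewrite bnd_simp.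
Qed.

Lemma order_isomorphic_ccc : order_isomorphic_to_unit_interval R T -> ccc oT.
Proof.
move=> [f [fbij fle]] F FO tF.
have [_ finj _] := fbij.
pose Q : set oT := [set x | exists q : rat, f x = ratr q].
have cQ : countable Q.
  apply: (countable_inj_preimage (g := f) (B := range (@ratr R))).
  - exact: (sub_countable (card_image_le _ _)).
  - by move=> x [q ->]; exists q.
  - by move=> x y _ _ fxy; apply: finj; rewrite ?inE.
apply: (disjoint_meeting_countable cQ tF) => A /FO[oA A0].
by have [x Ax Qx] := order_iso_dense_point fbij fle oA A0; exists x.
Qed.

End OrderTopologyCcc.

Section UltraOrderIso.
Context {R : realType} {X : metricType R}.
Variables (D : nat -> seq (set X)) (U : set_system nat).
Hypotheses (hD : chain_sequence D) (hU : nonprincipal_ultrafilter U).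
Notation T := (ultra_order hD hU).

Lemma ultra_ltP (x y : T) : (x < y)%O <-> ultra_le D U x y /\ x <> y.
Proof.
rewrite lt_neqAle; split.
  by move=> /andP[/eqP xy /ultra_orderE].
by move=> [/ultra_orderE -> /eqP ->].
Qed.

(** Of the cut formed by the points below some element of [A] and the remaining ones,
the last point of the lower part or the first point of the upper part exists. *)
Lemma ultra_le_lub (A : set T) : continuum X -> suslinean X ->
  A !=set0 -> exists p, isLub A p.
Proof.
move=> cX sX [a Aa].
have hle := ultra_continuum_order hD hU.
have hB := link_base_countable_base hD hU.
have [_ cptX conX] := cX.
pose L : set X := [set x | exists2 a : T, A a & (x <= a :> T)%O].
have La : L a by exists a.
have lubL p : order_max (ultra_le D U) L p -> isLub A p.
  move=> [[b Ab pb] pmax]; split.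
    by move=> x Ax; apply/ultra_orderE/pmax; exists x.
  by move=> y Ay; apply: le_trans pb _; exact: Ay.
have [[z Lz]|L'0] := pselect ((~` L) !=set0); last first.
  have [p [_ pmax]] := subcontinuum_max cptX hB sX hle cX.
  exists p; apply: lubL; split => [|x _]; last exact: pmax.
  by apply: contrapT => Lp; apply: L'0; exists p.
have [||||[[p Lp] _]|[[q [Lq qmin]] noL]] :=
    @continuum_cut R X cptX _ hB sX _ L (~` L) hle conX.
- by move=> x; have [|] := pselect (L x); [left|right].
- move=> x y [b Ab xb] nLy; split; last by move=> xy; apply: nLy; rewrite -xy; exists b.
  apply/(@ultra_orderE _ _ _ _ hD hU); rewrite leNgt; apply/negP => yx; apply: nLy.
  by exists b => //; apply: le_trans xb; exact: ltW.
- by exists a.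
- by exists z.
- by exists p; exact: lubL.
- exists q; split.
    move=> b Ab; rewrite leNgt; apply/negP => qb; apply: Lq; exists b => //.
    exact: ltW.
  move=> y Ay; have [Ly|nLy] := pselect (L y); last by apply/ultra_orderE/qmin.
  exfalso; apply: noL; exists y; split => // x [b Ab xb].
  by apply/(@ultra_orderE _ _ _ _ hD hU); apply: le_trans xb _; exact: Ay.
Qed.

Lemma suslinean_countable_order_dense : continuum X -> suslinean X ->
  exists2 S : set T, countable S &
    forall x y : T, (x < y)%O -> exists2 z, S z & (x < z < y)%O.
Proof.
move=> cX sX; have [_ cptX conX] := cX.
have hle := ultra_continuum_order hD hU.
have hB := link_base_countable_base hD hU.
have [S cS hS] := countable_set_meeting_subcontinua cptX hB sX hle.
exists S => // x y /ultra_ltP[xy nxy].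
have [s [Ss [xs sy nxs nsy]]] :=
  order_dense_of_meeting cptX hB sX hle conX hS xy nxy.
by exists s => //; apply/andP; split; apply/ultra_ltP.
Qed.

Lemma suslinean_order_isomorphic : continuum X -> nondegenerate_set [set: X] ->
  suslinean X -> order_isomorphic_to_unit_interval R T.
Proof.
move=> cX [u [v [_ _ uv]]] sX; have [_ cptX conX] := cX.
have hle := ultra_continuum_order hD hU.
have hdle := continuum_order_dual hle.
have hB := link_base_countable_base hD hU.
have [M [_ Mmax]] := subcontinuum_max cptX hB sX hle cX.
have [m [_ mmin]] := subcontinuum_max cptX hB sX hdle cX.
have [S cS hS] := suslinean_countable_order_dense cX sX.
have bnd (x : T) : ((m : T) <= x <= (M : T))%O.
  by apply/andP; split; apply/ultra_orderE; [exact: mmin|exact: Mmax].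
apply: (@order_isomorphic_of_separable R _ T S m M) => //.
- rewrite lt_neqAle; apply/andP; split; last by case/andP: (bnd M).
  apply/eqP => mM; apply: uv; apply: (co_anti hle).
    apply: (co_trans hle (y := M)); first exact: Mmax.
    by rewrite -mM; exact: mmin.
  apply: (co_trans hle (y := M)); first exact: Mmax.
  by rewrite -mM; exact: mmin.
- by move=> A; exact: ultra_le_lub.
Qed.

(** By convexity a nondegenerate continuum contains a whole open interval, between
any two of its points. *)
Lemma nondegenerate_contains_interval (K : set X) : subcontinuum K ->
  nondegenerate_set K ->
  exists a b c : T, [/\ (a < b)%O, (b < c)%O & `]a, c[%classic `<=` (K : set T)].
Proof.
move=> sK [u [v [Ku Kv uv]]]; have hle := ultra_continuum_order hD hU.
have [w [Kw wu wv]] : exists w, [/\ K w, w <> u & w <> v].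
  apply: contrapT => h; have [_ _ conK] := sK.
  have hX : hausdorff_space X by exact: metric_hausdorff.
  have c1 (x : X) : closed [set x] by exact: compact_closed (@compact_set1 _ x).
  have [||Ku'|Kv'] := connected_sub_closedU conK (c1 u) (c1 v).
  - by apply/disjoints_subset => z ->.
  - move=> z Kz; have [->|zu] := pselect (z = u); first by left.
    have [->|zv] := pselect (z = v); first by right.
    by exfalso; apply: h; exists z.
  - by apply: uv; rewrite (Ku' v Kv).
  - by apply: uv; rewrite (Kv' u Ku).
have conv (a c : T) : K a -> K c -> `]a, c[%classic `<=` (K : set T).
  move=> Ka Kc x; rewrite /= in_itv => /andP[/ltW/ultra_orderE ax /ltW/ultra_orderE xc].
  exact: (co_convex hle sK Ka Kc).
have [a [b [c [Ka Kb Kc ab bc]]]] : exists a b c : T,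
    [/\ K a, K b, K c, (a < b)%O & (b < c)%O].
  wlog uv' : u v Ku Kv uv wu wv / ((u : T) < (v : T))%O => [wl|].
    case: (ltgtP (u : T) (v : T)) => [uv'|vu|//]; first exact: (wl u v).
    by apply: (wl v u) => // /esym.
  case: (ltgtP (w : T) (u : T)) => [w_u|uw|//]; first by exists w, u, v.
  case: (ltgtP (w : T) (v : T)) => [w_v|vw|//]; first by exists u, w, v.
  by exists u, v, w.
by exists a, b, c; split => //; exact: conv.
Qed.

(** Disjoint nondegenerate continua contain disjoint open intervals. *)
Lemma ccc_suslinean : ccc (order_topology T) -> suslinean X.
Proof.
move=> hccc F FK tF.
have /choice[I hI] (K : set X) : exists I : set (order_topology T), F K ->
    [/\ open I, I !=set0 & I `<=` (K : set T)].
  have [FKK|] := pselect (F K); last by exists set0.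
  have [sK ndK] := FK K FKK.
  have [a [b [c [ab bc acK]]]] := nondegenerate_contains_interval sK ndK.
  exists `]a, c[%classic => _; split => //; first exact: itv_open.
  by exists b; rewrite /= in_itv /= ab.
apply: (countable_inj_preimage (g := I) (B := I @` F)).
- apply: hccc => [_ [K FKK <-]|_ _ [K FKK <-] [K' FKK' <-] [x [Kx K'x]]].
    by have [] := hI K FKK.
  congr (I _); apply: tF => //; exists x; have [_ _ h] := hI K FKK.
  by have [_ _ h'] := hI K' FKK'; split; [exact: h|exact: h'].
- by move=> K FKK; exists K.
- move=> K K' FKK FKK' IKK'; apply: tF => //.
  have [_ [x Ix] h] := hI K FKK; have [_ _ h'] := hI K' FKK'.
  by exists x; split; [exact: h|apply: h'; rewrite -IKK'].
Qed.

End UltraOrderIso.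

(** * Borel sets and the order topology *)

Section BorelSets.
Context {X : topologicalType}.
Notation borel := (<<s @open X >>).

Lemma borel_open (O : set X) : open O -> borel O.
Proof. by move=> oO; exact: sub_sigma_algebra. Qed.

Lemma borelC (A : set X) : borel A -> borel (~` A).
Proof.
move=> bA; have [_ h _] := smallest_sigma_algebra setT (@open X).
by have := h A bA; rewrite setTD.
Qed.

Lemma borel_closed (A : set X) : closed A -> borel A.
Proof.
by move=> cA; rewrite -(setCK A); apply: borelC; apply: borel_open; exact: closed_openC.
Qed.

Lemma borel_bigcup (F : nat -> set X) : (forall n, borel (F n)) ->
  borel (\bigcup_n F n).
Proof.
by move=> bF; have [_ _ h] := smallest_sigma_algebra setT (@open X); exact: h.
Qed.

Lemma borel_countable_bigcup (F : set (set X)) : countable F ->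
  (forall A, F A -> borel A) -> borel (\bigcup_(A in F) A).
Proof.
move=> cF bF; have [F0|F0] := pselect (F !=set0); last first.
  rewrite (_ : F = set0) ?bigcup_set0; first by apply: borel_open; exact: open0.
  by apply/seteqP; split => // A FA; apply: F0; exists A.
have [f rf] := countable_enumeration cF F0.
rewrite (_ : \bigcup_(A in F) A = \bigcup_n f n).
  by apply: borel_bigcup => n; apply: bF; rewrite -rf; exists n.
by rewrite -rf bigcup_image.
Qed.

Lemma borelI (A B : set X) : borel A -> borel B -> borel (A `&` B).
Proof.
move=> bA bB; rewrite -(setCK (A `&` B)) setCI; apply: borelC.
rewrite -bigcup2E; apply: borel_bigcup => -[|[|n]] /=; [exact: borelC|exact: borelC|].
by apply: borel_open; exact: open0.
Qed.

End BorelSets.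

(** The ray is the union, over [k], of the components of the complement of the ball
of radius [1/k] around the end point that lie in the ray; the nondegenerate
ones, which suffice, are countably many. *)
Lemma suslinean_ray_borel {R : realType} {X : metricType R}
    (le : X -> X -> Prop) (x : X) : continuum X -> suslinean X ->
  continuum_order le -> <<s @open X >> [set y | le y x /\ y <> x].
Proof.
move=> cX sX hle; have [_ cptX conX] := cX.
pose W := [set y | le y x /\ y <> x]; rewrite -/W.
pose E (k : nat) := ~` ball x (k.+1%:R^-1 : R).
have cE k : closed (E k) by apply: open_closedC; exact: metric_ball_open.
pose C k := [set A | [/\ exists2 y, E k y & A = connected_component (E k) y,
  nondegenerate_set A & A `<=` W]].
have sC k A : C k A -> subcontinuum A.
  by move=> [[y Ey ->] _ _]; exact: component_subcontinuum.
rewrite (_ : W = \bigcup_k \bigcup_(A in C k) A).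
  apply: borel_bigcup => k; apply: borel_countable_bigcup.
    apply: sX => [A CA|]; first by split; [exact: sC CA|case: CA].
    move=> A A' [[y _ ->] _ _] [[y' _ ->] _ _] [z [yz y'z]].
    by rewrite (same_connected_component yz) (same_connected_component y'z).
  by move=> A CA; apply: borel_closed; apply: subcontinuum_closed; exact: sC CA.
apply/seteqP; split => [y [yx nyx]|y [k _ [A [_ _ AW] Ay]]]; last exact: AW.
have d0 : 0 < mdist x y by rewrite mdist_gt0; apply/eqP => /esym.
have [k kxy] : exists k : nat, k.+1%:R^-1 < mdist x y.
  have [k _ hk] := near_infty_natSinv_lt (PosNum d0).
  by exists k; exact: (hk k (leqnn k)).
have ndX : nondegenerate_set [set: X] by exists y, x.
have e0 : 0 < mdist x y - k.+1%:R^-1 by rewrite subr_gt0.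
have [M [sM ndM My _ Mb]] := small_subcontinuum cptX cX ndX (I : setT y) e0.
have ME : M `<=` E k.
  move=> z /Mb /ballP yz /ballP xz; have := metric_triangle x z y.
  by rewrite (metric_sym z y) leNgt (lt_le_trans (ltrD xz yz))// addrC subrK.
have Ey := ME y My.
have MC : M `<=` connected_component (E k) y.
  by apply: connected_component_max => //; case: sM.
have sCy := component_subcontinuum cptX (cE k) Ey.
exists k => //; exists (connected_component (E k) y); last exact: MC.
split; first by exists y.
  by have [u [v [Mu Mv uv]]] := ndM; exists u, v; split => //; exact: MC.
have nx : ~ connected_component (E k) y x.
  move=> /connected_component_sub; apply; apply/ballP.
  by rewrite mdistxx invr_gt0 ltr0n.
move=> z Cz; split; last by move=> zx; apply: nx; rewrite -zx.
have [//|xz] := co_total hle z x.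
by case: nx; exact: (co_convex hle sCy (MC y My) Cz yx xz).
Qed.

Section BorelOrder.
Context {R : realType} {X : metricType R}.
Variables (D : nat -> seq (set X)) (U : set_system nat).
Hypotheses (hD : chain_sequence D) (hU : nonprincipal_ultrafilter U).
Notation T := (ultra_order hD hU).
Notation oT := (order_topology T).

(** With a countable order-dense set of end points the order topology has a countable
base of intervals, all of which are Borel. *)
Lemma suslinean_order_open_borel (O : set oT) : continuum X -> suslinean X ->
  nondegenerate_set [set: X] -> open O -> <<s @open X >> (O : set X).
Proof.
move=> cX sX [u [v [_ _ uv]]] oO.
have hle := ultra_continuum_order hD hU.
have [S cS dS] := suslinean_countable_order_dense hD hU cX sX.
have S0 : S !=set0.
  case: (ltgtP (u : T) (v : T)) => [/dS[z Sz _]|/dS[z Sz _]|//]; by exists z.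
have [s rs] := countable_enumeration cS S0.
have sd (x y : T) : (x < y)%O -> exists n, (x < s n < y)%O.
  by move=> /dS[z + xz]; rewrite -rs => -[n _ sn]; exists n; rewrite sn.
pose above (o : option nat) : set T := if o is Some n then `]s n, +oo[%classic else setT.
pose below (o : option nat) : set T := if o is Some n then `]-oo, s n[%classic else setT.
have babove o : <<s @open X >> (above o : set X).
  case: o => [n|]; last by apply: borel_open; exact: openT.
  rewrite (_ : (above (Some n) : set X) = [set y | ultra_le D U (s n) y /\ y <> s n]).
    exact: (@suslinean_ray_borel _ _ (fun x y => ultra_le D U y x) _ cX sX
              (continuum_order_dual hle)).
  apply/seteqP; split => y; rewrite /= in_itv /= andbT.
    by move=> /ultra_ltP[? h]; split => // /esym.
  by move=> [? h]; apply/ultra_ltP; split => // /esym.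
have bbelow o : <<s @open X >> (below o : set X).
  case: o => [n|]; last by apply: borel_open; exact: openT.
  rewrite (_ : (below (Some n) : set X) = [set y | ultra_le D U y (s n) /\ y <> s n]).
    exact: suslinean_ray_borel.
  by apply/seteqP; split => y; rewrite /= in_itv /= => /ultra_ltP.
pose I (q : option nat * option nat) : set X := above q.1 `&` below q.2.
pose F := I @` [set q | I q `<=` (O : set X)].
rewrite (_ : (O : set X) = \bigcup_(A in F) A).
  apply: borel_countable_bigcup; first exact: (sub_countable (card_image_le _ _)).
  by move=> _ [q _ <-]; apply: borelI; [exact: babove|exact: bbelow].
apply/seteqP; split=> [x Ox|x [_ [q qO <-] /qO]//].
have : nbhs (x : oT) O by apply: open_nbhs_nbhs.
rewrite order_nbhs_itv => -[[l r] [oi xi] iO].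
have [a ax al] : exists2 a, above a x & above a `<=` [set y | (l <= BLeft y)%O].
  case: l oi xi iO => [bl a|bl] oi xi iO.
    have bF : bl = false by exact: itv_open_ends_lside oi.
    have : (a < x)%O.
      by move: xi; rewrite bF itv_boundlr => /andP[+ _]; rewrite bnd_simp.
    move=> /sd[n /andP[an nx]]; exists (Some n); rewrite /= ?in_itv /= ?nx//.
    move=> y; rewrite /= in_itv /= andbT bF bnd_simp; exact: lt_trans.
  have -> : bl = true by exact: itv_open_ends_linfty oi.
  by exists None.
have [b xb br] : exists2 b, below b x & below b `<=` [set y | (BRight y <= r)%O].
  case: r oi xi iO => [bl b|bl] oi xi iO.
    have bF : bl = true by exact: itv_open_ends_rside oi.
    have : ((x : oT) < b)%O.
      by move: xi; rewrite bF itv_boundlr => /andP[_]; rewrite bnd_simp.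
    move=> /sd[n /andP[xn nb]]; exists (Some n); rewrite /= ?in_itv /= ?xn//.
    move=> y; rewrite /= in_itv /= bF bnd_simp => yn; exact: lt_trans nb.
  have -> : bl = false by exact: itv_open_ends_rinfty oi.
  by exists None.
exists (I (a, b)); last by [].
exists (a, b) => // y [ay yb]; apply: iO.
by rewrite /= itv_boundlr; apply/andP; split; [exact: al|exact: br].
Qed.

Lemma suslinean_borel_measurable : continuum X -> suslinean X ->
  nondegenerate_set [set: X] -> borel_measurable (idfun : X -> oT).
Proof.
move=> cX sX ndX B; rewrite /borel_measurable preimage_id.
pose P := [set B : set oT | <<s @open X >> (B : set X)].
suff : <<s @open oT >> `<=` P by apply.
apply: smallest_sub; last first.
  by move=> O oO; exact: suslinean_order_open_borel.
split.
- by apply: borel_open; exact: open0.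
- by move=> A PA; rewrite setTD; exact: borelC.
- by move=> F PF; exact: borel_bigcup.
Qed.

End BorelOrder.

(** * The Suslin operation and limits of continua *)

Section SuslinOperation.
Context {T : Type}.
Variable G : nat -> set T.
Implicit Types (A : set T) (c : seq nat -> nat).

(** The Suslin operation on the scheme [fun s => G (c s)]. *)
Definition suslin_set c : set T :=
  [set x | exists a : nat -> nat, forall n, G (c (mkseq a n)) x].

Definition suslin A := exists c, A = suslin_set c.

Lemma suslin_gen k : suslin (G k).
Proof.
exists (fun=> k); apply/seteqP; split=> x; first by move=> Gx; exists (fun=> 0%N).
by move=> [a /(_ 0%N)].
Qed.

Hypothesis suslinT : exists k, G k = setT.

Lemma suslin_bigcup (A : nat -> set T) : (forall i, suslin (A i)) ->
  suslin (\bigcup_i A i).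
Proof.
move=> /choice[c hc]; have [k kT] := suslinT.
exists (fun s => if s is i :: s' then c i s' else k).
apply/seteqP; split => x.
  move=> [i _]; rewrite hc => -[a ha].
  exists (fun n => if n is m.+1 then a m else i) => -[|n]; first by rewrite kT.
  rewrite /mkseq /= -[1%N]addn0 iotaDl -map_comp; exact: ha.
move=> [a ha]; exists (a 0%N) => //; rewrite hc; exists (fun n => a n.+1) => n.
by have := ha n.+1; rewrite /mkseq /= -[1%N]addn0 iotaDl -map_comp.
Qed.

(** The pairing increases with its second argument, so that a prefix of length
[diagonal_pair i n] of a sequence indexed by pairs contains the first [n] terms of
its [i]-th row. *)
Definition diagonal_pair (i j : nat) : nat := (i + j) * (i + j) + i.

Lemma diagonal_pair_inj i j i' j' :
  diagonal_pair i j = diagonal_pair i' j' -> (i, j) = (i', j').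
Proof.
rewrite /diagonal_pair => h.
have e : (i + j = i' + j')%N.
  case: (ltngtP (i + j) (i' + j')) => // lt.
    have : ((i + j).+1 * (i + j).+1 <= (i' + j') * (i' + j'))%N by exact: leq_mul.
    by lia.
  have : ((i' + j').+1 * (i' + j').+1 <= (i + j) * (i + j))%N by exact: leq_mul.
  by lia.
by congr pair; move: h; rewrite e; lia.
Qed.

Lemma diagonal_pair_lt i j n : (j < n)%N -> (diagonal_pair i j < diagonal_pair i n)%N.
Proof. by rewrite /diagonal_pair => jn; nia. Qed.

Definition diagonal_unpair (m : nat) : nat * nat :=
  xget (0%N, 0%N) [set q | diagonal_pair q.1 q.2 = m].

Lemma diagonal_pairK i j : diagonal_unpair (diagonal_pair i j) = (i, j).
Proof.
rewrite /diagonal_unpair; case: xgetP => [[i' j'] _ /= /diagonal_pair_inj //|].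
by move=> /(_ (i, j)) [].
Qed.

(** The rows of a single sequence carry the witnesses for all the sets [A i]; its prefix
of length [diagonal_pair i n] serves to check the [n]-th condition for [A i]. *)
Lemma suslin_bigcap (A : nat -> set T) : (forall i, suslin (A i)) ->
  suslin (\bigcap_i A i).
Proof.
move=> /choice[c hc]; have [k kT] := suslinT.
pose row i n (s : seq nat) := mkseq (fun j => nth 0%N s (diagonal_pair i j)) n.
exists (fun s => let q := diagonal_unpair (size s) in
  if diagonal_pair q.1 q.2 == size s then c q.1 (row q.1 q.2 s) else k).
have rowE i n a : row i n (mkseq a (diagonal_pair i n)) =
    mkseq (fun j => a (diagonal_pair i j)) n.
  apply: (@eq_from_nth _ 0%N); rewrite !size_mkseq // => j jn.
  by rewrite !nth_mkseq //; exact: diagonal_pair_lt.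
apply/seteqP; split => x.
  move=> Ax; have /choice[a ha] i : exists a, forall n, G (c i (mkseq a n)) x.
    by have := Ax i I; rewrite hc.
  pose b m := let q := diagonal_unpair m in a q.1 q.2.
  exists b => m; rewrite size_mkseq.
  case: (diagonal_unpair m) => i n /=; case: eqP => [<-|_]; last by rewrite kT.
  rewrite rowE (_ : mkseq _ n = mkseq (a i) n); first exact: ha.
  by apply: eq_mkseq => j; rewrite /b diagonal_pairK.
move=> [a ha] i _; rewrite hc; exists (fun j => a (diagonal_pair i j)) => n.
by have := ha (diagonal_pair i n); rewrite size_mkseq diagonal_pairK /= eqxx rowE.
Qed.

End SuslinOperation.

Section BorelSuslin.
Context {T : topologicalType}.
Variable G : nat -> set T.
Hypothesis hT : hausdorff_space T.
(** The sets [G k] interpolate between closed sets and their open neighbourhoods. *)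
Hypothesis hG : forall C O : set T, closed C -> open O -> C `<=` O ->
  exists k, C `<=` G k /\ G k `<=` O.

Lemma interpolating_setT : exists k, G k = setT.
Proof.
have [k [h _]] := hG (closedT (T := T)) openT (@subsetT _ setT).
by exists k; apply/seteqP; split.
Qed.

Lemma interpolating_set0 : exists k, G k = set0.
Proof.
have [k [_ h]] := hG (closed0 (T := T)) open0 (@sub0set _ set0).
by exists k; apply/seteqP; split.
Qed.

Lemma open_suslin (O : set T) : open O -> suslin G O.
Proof.
move=> oO; have [k0 G0] := interpolating_set0.
rewrite (_ : O = \bigcup_k (if `[< G k `<=` O >] then G k else set0)).
  apply: suslin_bigcup => [|k]; first exact: interpolating_setT.
  by case: asboolP => _; [|rewrite -G0]; exact: suslin_gen.
apply/seteqP; split => x.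
  move=> Ox; have c1 : closed [set x] by exact: compact_closed (@compact_set1 _ x).
  have [|k [xG GO]] := hG c1 oO; first by move=> _ ->.
  by exists k => //; case: asboolP => // _; exact: xG.
by move=> [k _]; case: asboolP => // h; exact: h.
Qed.

Lemma closed_suslin (C : set T) : closed C -> suslin G C.
Proof.
move=> cC; have [k0 G1] := interpolating_setT.
rewrite (_ : C = \bigcap_k (if `[< C `<=` G k >] then G k else setT)).
  apply: suslin_bigcap => [|k]; first exact: interpolating_setT.
  by case: asboolP => _; [|rewrite -G1]; exact: suslin_gen.
apply/seteqP; split => x.
  by move=> Cx k _; case: asboolP => // h; exact: h.
move=> h; apply: contrapT => nCx.
have c1 : closed [set x] by exact: compact_closed (@compact_set1 _ x).
have [|k [CG Gx]] := hG cC (closed_openC c1).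
  by move=> y Cy yx; apply: nCx; rewrite -yx.
by have := h k I; case: asboolP => // _ Gkx; exact: (Gx x Gkx).
Qed.

(** The sets that have a code together with their complement form a sigma-algebra. *)
Lemma borel_suslin (A : set T) : <<s @open T >> A -> suslin G A.
Proof.
pose P := [set A : set T | suslin G A /\ suslin G (~` A)].
suff h : <<s @open T >> `<=` P by move=> /h[].
apply: smallest_sub; last first.
  by move=> O oO; split; [exact: open_suslin|exact/closed_suslin/open_closedC].
have sT := interpolating_setT.
split.
- have [k0 G0] := interpolating_set0; have [k1 G1] := sT.
  by rewrite /P /= setC0 -{1}G0 -G1; split; exact: suslin_gen.
- by move=> A0 [? ?]; rewrite setTD; split; rewrite ?setCK.
- move=> F PF; split; first by apply: suslin_bigcup => // i; case: (PF i).
  by rewrite setC_bigcup; apply: suslin_bigcap => // i; case: (PF i).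
Qed.

End BorelSuslin.

Section DisjointContinua.
Context {R : realType} {X : metricType R}.
Hypothesis cptX : compact [set: X].
Variable B : nat -> set X.
Hypothesis hB : countable_base B.
Implicit Types (C E K L O : set X).

Definition interpolation (k : nat) : set X :=
  if unpickle k is Some l then \bigcup_(i in [set` (l : seq nat)]) closure (B i) else set0.

Lemma interpolation_closed k : closed (interpolation k).
Proof.
rewrite /interpolation; case: unpickle => [l|]; last exact: closed0.
by apply: closed_bigcup => [|i _]; [exact: finite_seq|exact: closed_closure].
Qed.

Lemma interpolationP C O : closed C -> open O -> C `<=` O ->
  exists k, C `<=` interpolation k /\ interpolation k `<=` O.
Proof.
move=> cC oO CO.
pose good (l : seq nat) := forall i, i \in l -> closure (B i) `<=` O.
pose F := [set A | exists2 l, good l & A = C `\` \bigcup_(i in [set` l]) B i].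
have [|||||_ [l gl ->] l0] := @directed_closed_sub_open X F set0 cptX.
- by exists (C `\` \bigcup_(i in [set` [::]]) B i), [::].
- move=> _ [l _ ->]; apply: closedI => //; apply: open_closedC.
  by apply: bigcup_open => i _; case: hB => h _; exact: h.
- move=> _ _ [l gl ->] [l' gl' ->]; exists (C `\` \bigcup_(i in [set` l ++ l']) B i).
    exists (l ++ l') => // i; rewrite mem_cat => /orP[]; [exact: gl|exact: gl'].
  move=> x [Cx nx]; split; split => // -[i /= il Bi]; apply: nx; exists i => //=;
    by rewrite mem_cat il ?orbT.
- exact: open0.
- move=> x Fx; have [Cx _] : (C `\` \bigcup_(i in [set` [::]]) B i) x.
    by apply: Fx; exists [::].
  have [V [oV Vx VO]] := metric_regular_open oO (CO x Cx).
  have [e e0 eV] := open_ball_sub oV Vx.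
  have [_ /(_ x e e0)[i [Bix Bie]]] := hB.
  have : (C `\` \bigcup_(j in [set` [:: i]]) B j) x.
    apply: Fx; exists [:: i] => // j; rewrite inE => /eqP ->.
    apply: subset_trans VO; apply: closureS; exact: subset_trans eV.
  by move=> [_]; apply; exists i => //=; rewrite inE.
exists (pickle l); rewrite /interpolation pickleK; split => x.
  move=> Cx; apply: contrapT => nx; apply: (l0 x); split => // -[i il Bi].
  by apply: nx; exists i => //; exact: subset_closure.
by move=> [i il]; exact: gl.
Qed.

(** A limit of the given continua: their points [x n] and [y n] converge along an
ultrafilter to points of [\bigcap_n E n] that no splitting of this intersection
separates. *)
Lemma nested_contains_subcontinuum (E : nat -> set X) (e : R) : 0 < e ->
  (forall n, closed (E n)) -> (forall n, E n.+1 `<=` E n) ->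
  (forall n, exists K, [/\ subcontinuum K, K `<=` E n &
     exists x y, [/\ K x, K y & e <= mdist x y]]) ->
  exists K, [/\ subcontinuum K, nondegenerate_set K & K `<=` \bigcap_n E n].
Proof.
move=> e0 cE Edec hK.
have /choice[q hq] n : exists q : set X * (X * X), [/\ subcontinuum q.1,
    q.1 `<=` E n, q.1 q.2.1, q.1 q.2.2 & e <= mdist q.2.1 q.2.2].
  by have [K [sK KE [x [y [Kx Ky xy]]]]] := hK n; exists (K, (x, y)).
pose x_ n := (q n).2.1; pose y_ n := (q n).2.2.
have EE m n : (m <= n)%N -> E n `<=` E m.
  elim: n => [|n IH]; first by rewrite leqn0 => /eqP ->.
  rewrite leq_eqVlt => /orP[/eqP <-//|/IH h]; exact: subset_trans h.
have [U [UU oU]] := ultraFilterLemma (F := \oo).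
have UF : ProperFilter U by exact: ultra_proper.
have lim (u : nat -> X) : exists l, forall O, open O -> O l -> U (u @^-1` O).
  have [l [_ ul]] := @cptX (u @ U) _ filterT; exists l => O oO Ol.
  have [//|nO] := in_ultra_setVsetC (u @^-1` O) UU.
  by have [z [nOz Oz]] := ul (~` O) O nO (open_nbhs_nbhs (conj oO Ol)).
have [x hx] := lim x_; have [y hy] := lim y_.
have UN n : U [set m | (n <= m)%N] by apply: oU; exists n.
pose I := \bigcap_n E n.
have cI : closed I by exact: closed_bigI.
have inI (u : nat -> X) l : (forall n, E n (u n)) ->
    (forall O, open O -> O l -> U (u @^-1` O)) -> I l.
  move=> uE hu n _; apply: contrapT => nl.
  have := hu _ (closed_openC (cE n)) nl => /(filterI (UN n))/filter_ex[m [/= nm]].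
  by apply; apply: EE nm _ (uE m).
have Ix : I x by apply: (inI x_) => // n; have [_ h1 h2 _ _] := hq n; exact: h1.
have hX : hausdorff_space X by exact: metric_hausdorff.
exists (quasicomponent I x); split.
- apply: closed_subcontinuum => //; first by exists x => A [].
    by apply: closed_bigI => A [[]].
  exact: quasicomponent_connected.
- exists x, y; split; first by move=> A [].
    move=> P [[cP [P' [cP' PI P0]]] Px]; apply: contrapT => nPy.
    have P'y : P' y.
      have : I y by apply: (inI y_) => // n; have [_ h1 _ h2 _] := hq n; exact: h1.
      by rewrite -PI => -[].
    have [A [A' [oA oA' PA PA' AA']]] := disjoint_closed_separated hX cptX cP cP' P0.
    have [|||||_ [n _ <-] En] := @directed_closed_sub_open X (range E) (A `|` A') cptX.
    + by exists (E 0%N), 0%N.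
    + by move=> _ [n _ <-].
    + move=> _ _ [m _ <-] [n _ <-]; exists (E (maxn m n)); first by exists (maxn m n).
      by move=> z Ez; split; apply: EE Ez; [exact: leq_maxl|exact: leq_maxr].
    + exact: openU.
    + move=> z hz; have : I z by move=> n _; apply: hz; exists n.
      by rewrite -PI => -[/PA|/PA'] ?; [left|right].
    have /filter_ex[m [/= nm [Axm Aym]]] : U ([set m | (n <= m)%N] `&`
        (x_ @^-1` A `&` y_ @^-1` A')).
      apply: filterI; first exact: UN.
      by apply: filterI; [apply: hx => //; exact: PA|apply: hy => //; exact: PA'].
    have [[_ _ conq] qE qx qy _] := hq m.
    have qAA' : (q m).1 `<=` A `|` A' by move=> z /qE /(EE _ _ nm) /En.
    have [qA|qA'] := connected_sub_openU conq oA oA' AA' qAA'.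
      by have : (A `&` A') (y_ m); [split => //; exact: qA|rewrite AA'].
    by have : (A `&` A') (x_ m); [split => //; exact: qA'|rewrite AA'].
  move=> xy; have e2 : 0 < e / 2 by rewrite divr_gt0.
  have b2 (z : X) : ball z (e / 2) z by apply/ballP; rewrite mdistxx.
  have /filter_ex[m [xm ym]] : U (x_ @^-1` ball x (e / 2) `&`
      y_ @^-1` ball x (e / 2)).
    apply: filterI; first by apply: hx => //; exact: metric_ball_open.
    by rewrite xy; apply: hy => //; exact: metric_ball_open.
  have {}xm : mdist x (x_ m) < e / 2 by exact/ballP.
  have {}ym : mdist x (y_ m) < e / 2 by exact/ballP.
  have [_ _ _ _] := hq m; rewrite leNgt => /negP; apply.
  apply: le_lt_trans (metric_triangle _ x _) _.
  by rewrite (metric_sym _ x) [ltRHS]splitr; exact: ltrD.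
- exact: quasicomponent_sub.
Qed.

End DisjointContinua.

(** * Perfect families of disjoint continua *)

Section PerfectFamily.
Context {R : realType} {X : metricType R}.
Hypothesis cptX : compact [set: X].
Variable B : nat -> set X.
Hypothesis hB : countable_base B.
Implicit Types (E K L : set X) (F : set (set X)).

Definition members_within F E := [set K | F K /\ K `<=` E].

(** Members lying in some interpolating set with only countably many members are
themselves countably many; two of the remaining members, being disjoint, lie in
disjoint interpolating sets. *)
Lemma uncountable_members_split F E :
  (forall K, F K -> subcontinuum K) -> trivIset F id ->
  closed E -> ~ countable (members_within F E) ->
  exists E0 E1, [/\ closed E0 /\ ~ countable (members_within F E0),
    closed E1 /\ ~ countable (members_within F E1), E0 `&` E1 = set0,
    E0 `<=` E & E1 `<=` E].
Proof.
move=> sF tF cE nE.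
pose G := interpolation B.
have cG k : closed (G k) by exact: interpolation_closed.
pose W k := members_within F (E `&` G k).
pose small := \bigcup_(k in [set k | countable (W k)]) W k.
have csmall : countable small by apply: bigcup_countable.
pose F' := members_within F E `\` small.
have nF' : ~ countable F'.
  move=> cF'; apply: nE.
  apply: (@sub_countable _ _ _ (F' `|` small)).
    apply: subset_card_le => K FK.
    by have [|] := pselect (small K); [right|left].
  by rewrite -bigcup2E; apply: bigcup_countable => // -[|[|?]].
have [K [L [F'K F'L KL]]] : exists K L, [/\ F' K, F' L & K <> L].
  apply: contrapT => h; apply: nF'.
  have [[K F'K]|F'0] := pselect (F' !=set0); last first.
    by rewrite (_ : F' = set0)//; apply/seteqP; split => // K ?; apply: F'0; exists K.
  rewrite (_ : F' = [set K]); first exact: countable1.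
  apply/seteqP; split => [L F'L /=|_ ->//]; apply: contrapT => LK.
  by apply: h; exists K, L; split => // /esym.
have [[[FK KE] nsK] [[FL LE] nsL]] := (F'K, F'L).
have KL0 : K `&` L = set0.
  by apply/eqP/negPn/negP => /set0P KL0; apply: KL; exact: tF.
have [cK cL] := (subcontinuum_closed (sF K FK), subcontinuum_closed (sF L FL)).
have hX : hausdorff_space X by exact: metric_hausdorff.
have [A [A' [oA oA' KA LA' AA']]] := disjoint_closed_separated hX cptX cK cL KL0.
have [k [KG GA]] := interpolationP cptX hB cK oA KA.
have [k' [LG GA']] := interpolationP cptX hB cL oA' LA'.
have big K' j : F K' -> K' `<=` E -> K' `<=` G j -> ~ small K' -> ~ countable (W j).
  move=> FK' K'E K'G nsK' cWj; apply: nsK'; exists j => //; split => // x K'x.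
  by split; [exact: K'E|exact: K'G].
exists (E `&` G k), (E `&` G k'); split.
- by split; [exact: closedI|exact: (big K)].
- by split; [exact: closedI|exact: (big L)].
- apply/disjoints_subset => x [_ /GA Ax] [_ /GA' A'x].
  by have : (A `&` A') x by []; rewrite AA'.
- by move=> x [].
- by move=> x [].
Qed.

(** A Cantor scheme of disjoint closed sets, each containing uncountably many members
of the family; each branch shrinks to a set that still contains a continuum. *)
Lemma not_suslinean_perfect_family : ~ suslinean X ->
  exists K : (nat -> bool) -> set X,
    (forall t, subcontinuum (K t) /\ nondegenerate_set (K t)) /\
    forall t u n, t n != u n -> K t `&` K u = set0.
Proof.
move=> nS.
have [F [hF tF nF]] : exists F, [/\ forall K, F K -> subcontinuum K /\ nondegenerate_set K,
    trivIset F id & ~ countable F].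
  apply: contrapT => h; apply: nS => F hF tF; apply: contrapT => nF.
  by apply: h; exists F.
pose wide (k : nat) := [set K | F K /\
  exists x y, [/\ K x, K y & k.+1%:R^-1 <= mdist x y]].
have [k nk] : exists k, ~ countable (wide k).
  apply: contrapT => /forallNP h; apply: nF.
  apply: (@sub_countable _ _ _ (\bigcup_k wide k)); last first.
    by apply: bigcup_countable => // k _; apply: contrapT; exact: h.
  apply: subset_card_le => K FK; have [_ [x [y [Kx Ky xy]]]] := hF K FK.
  have d0 : 0 < mdist x y by rewrite mdist_gt0; apply/eqP.
  have [k _ hk] := near_infty_natSinv_lt (PosNum d0).
  by exists k => //; split => //; exists x, y; split => //; apply/ltW/(hk k (leqnn k)).
have tW : trivIset (wide k) id by move=> K L [FK _] [FL _]; exact: tF.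
have sW K : wide k K -> subcontinuum K by move=> [/hF[]].
pose good E := closed E /\ ~ countable (members_within (wide k) E).
have /choice[split hsplit] (E : set X) : exists p : set X * set X, good E ->
    [/\ good p.1, good p.2, p.1 `&` p.2 = set0, p.1 `<=` E & p.2 `<=` E].
  have [[cE nE]|] := pselect (good E); last by exists (set0, set0).
  have [E0 [E1 h]] := uncountable_members_split sW tW cE nE.
  by exists (E0, E1).
pose node := fix node (t : nat -> bool) n := if n is m.+1
  then if t m then (split (node t m)).1 else (split (node t m)).2 else setT.
have gnode t n : good (node t n).
  elim: n => [|n IH] /=.
    split; first exact: closedT.
    by rewrite /members_within (_ : [set _ | _] = wide k)//;
      apply/seteqP; split => K // [].
  by have [h0 h1 _ _ _] := hsplit _ IH; case: (t n).
have dec t n : node t n.+1 `<=` node t n.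
  by have [_ _ _ h0 h1] := hsplit _ (gnode t n); rewrite /=; case: (t n).
have /choice[K hK] t : exists K,
    [/\ subcontinuum K, nondegenerate_set K & K `<=` \bigcap_n node t n].
  apply: (@nested_contains_subcontinuum _ _ cptX (node t) k.+1%:R^-1).
  - by rewrite invr_gt0 ltr0n.
  - by move=> n; case: (gnode t n).
  - exact: dec.
  - move=> n; have [_ nc] := gnode t n.
    have [L [[FL Lxy] LE]] : members_within (wide k) (node t n) !=set0.
      apply/set0P/eqP => h; apply: nc; rewrite h; exact: countable0.
    by exists L; split => //; apply: sW.
exists K; split; first by move=> t; have [? ? _] := hK t.
move=> t u n; elim/ltn_ind: n => n IH tu.
have [[m mn tum]|same] := pselect (exists2 m, (m < n)%N & t m != u m).
  exact: IH tum.
have nodeE m : (m <= n)%N -> node t m = node u m.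
  elim: m => // m IHm mn /=; rewrite IHm ?(ltnW mn)//.
  have -> // : t m = u m.
  by apply/eqP/negPn/negP => tum; apply: same; exists m.
have [_ _ hd _ _] := hsplit _ (gnode t n).
have [_ _ ht] := hK t; have [_ _ hu] := hK u.
apply/disjoints_subset => x /ht/(_ n.+1 I) /= xt /hu/(_ n.+1 I) /=.
rewrite -nodeE//; move: xt tu; case: (t n); case: (u n) => //= x1 _ x2.
  by have : set0 x by rewrite -hd.
by have : set0 x by rewrite -hd.
Qed.

End PerfectFamily.

(** The graph of a code, as a branch of the binary tree. *)
Definition code_branch (c : seq nat -> nat) (m : nat) : bool :=
  if unpickle m is Some (s, k) then c s == k else false.

Lemma code_branch_inj c c' : c <> c' -> exists n, code_branch c n != code_branch c' n.
Proof.
move=> cc'; have [s ss] : exists s, c s <> c' s.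
  apply: contrapT => /forallNP h; apply: cc'; apply/funext => s.
  exact: contrapT (h s).
exists (pickle (s, c s)); rewrite /code_branch pickleK eqxx.
by apply/eqP => /esym/eqP /esym.
Qed.

Section BorelOrderSuslinean.
Context {R : realType} {X : metricType R}.
Variables (D : nat -> seq (set X)) (U : set_system nat).
Hypotheses (hD : chain_sequence D) (hU : nonprincipal_ultrafilter U).
Notation T := (ultra_order hD hU).
Notation oT := (order_topology T).

(** Every Borel set is [suslin_set G c] for one of the codes [c]. If [X] is not
Suslinean, then disjoint open intervals [I c] with points [z c] can be indexed by the
codes, and the union of those [I c] for which [suslin_set G c] misses [z c]
is open in the order topology but has no code. *)
Lemma borel_measurable_suslinean : continuum X ->
  borel_measurable (idfun : X -> oT) -> suslinean X.
Proof.
move=> cX hmeas; apply: contrapT => nS; have [_ cptX _] := cX.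
have hB := link_base_countable_base hD hU.
have [K [sK dK]] := not_suslinean_perfect_family cptX hB nS.
have /choice[q hq] c : exists q : set oT * oT,
    [/\ open q.1, q.1 q.2 & q.1 `<=` (K (code_branch c) : set T)].
  have [s1 s2] := sK (code_branch c).
  have [a [b [e [ab be aeK]]]] := nondegenerate_contains_interval hD hU s1 s2.
  exists (`]a, e[%classic, b); split => //=; first exact: itv_open.
  by rewrite in_itv /= ab be.
pose G := interpolation (link_base D).
(* The diagonal set: a code [c] of [O] would belong to [bad] iff it does not. *)
pose bad := [set c | ~ suslin_set G c (q c).2].
pose O : set oT := \bigcup_(c in bad) (q c).1.
have oO : open O by apply: bigcup_open => c _; case: (hq c).
have : <<s @open X >> (O : set X).
  by apply: (hmeas O); exact: sub_sigma_algebra.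
move=> /(borel_suslin (@metric_hausdorff _ X)
  (fun C O => interpolationP cptX hB (C := C) (O := O)))[c Oc].
have [_ qc cK] := hq c.
have nbad : ~ bad c.
  by move=> bc; apply: (bc); rewrite -/G -Oc; exists c.
have : suslin_set G c (q c).2 by apply: contrapT.
rewrite -/G -Oc => -[c' bc' qc'].
have [cc'|cc'] := pselect (c = c'); first by apply: nbad; rewrite cc'.
have [n tn] := code_branch_inj cc'.
have [_ _ c'K] := hq c'.
have : (K (code_branch c) `&` K (code_branch c')) (q c).2.
  by split; [exact: cK|exact: c'K].
by rewrite (dK _ _ n).
Qed.

End BorelOrderSuslinean.

(** * The equivalence *)

Theorem theorem5p6 (R : realType) (X : metricType R)
    (cX : continuum X) (ndX : nondegenerate_set [set: X]) (chX : chainable X)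
    (D : nat -> seq (set X)) (hD : chain_sequence D)
    (U : set_system nat) (hU : nonprincipal_ultrafilter U) :
  [<-> suslinean X;
       order_isomorphic_to_unit_interval R (ultra_order hD hU);
       ccc (order_topology (ultra_order hD hU));
       borel_measurable (idfun : X -> order_topology (ultra_order hD hU)) ].
Proof.
tfae.
- by move=> sX; exact: suslinean_order_isomorphic.
- exact: order_isomorphic_ccc.
- move=> /ccc_suslinean sX; exact: suslinean_borel_measurable.
- exact: borel_measurable_suslinean.
Qed.
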